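(* Suppose $\Lambda(X)=1$ and $\Lambda=\sum_{i\in\mathcal I}\lambda_i\Lambda_i$ on $\mathcal B$, where $\mathcal I$ is an at most countable set, $(\Lambda_i)_{i\in\mathcal I}$ is a family of distinct ergodic probability measures on $\mathcal B$, and $(\lambda_i)_{i\in\mathcal I}\subset(0,1]$. For each $i\in\mathcal I$ let $Z_i$ be a measurable version of the Radon-Nikodym derivative $d\Lambda_i/d\phi_0$ (on $\mathcal A_0$) and let $M_i\in(0,\infty]$ be the $\Lambda_i$-essential supremum of $Z_i$. Let $Q\in\mathcal B$. (i) The function $[0,1]\ni\alpha\mapsto\mathcal H_\alpha(\Lambda,\phi_0)(Q)$ is continuous at $0$ if and only if $$\Phi(Q)=\sum_{i\in\mathcal I}\frac1{M_i}\Lambda_i(Q).$$ (ii) The function $[0,1]\ni\alpha\mapsto\mathcal H_\alpha(\Lambda,\phi_0)(Q)$ is continuous at $0$ if $\phi_0\ll\Lambda$.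
   Context: Setting. Let $X$ be a set, $S:X\to X$ a bijection, $\mathcal A$ a $\sigma$-algebra on $X$, $\mathcal A_0$ the $\sigma$-algebra generated by $\bigcup_{i\ge 0}S^{-i}\mathcal A$, $\mathcal B$ the $\sigma$-algebra generated by $\bigcup_{i\in\mathbb Z}S^{-i}\mathcal A$, and $\mathcal A_m:=S^{-m}\mathcal A_0=\{S^{-m}A:A\in\mathcal A_0\}$ for integers $m\le 0$ (so $\mathcal A_0\subset\mathcal A_{-1}\subset\cdots$). Let $\phi_0$ be a finite positive measure on $\mathcal A_0$, and $\Lambda$ a finite positive measure on $\mathcal A_0$ with $\Lambda\circ S^{-1}=\Lambda$ and $\Lambda\ll\phi_0$; let $Z\ge0$ be an $\mathcal A_0$-measurable version of $d\Lambda/d\phi_0$. For $Q\subset X$ let $\mathcal C(Q)$ be the set of all sequences $(A_m)_{m\le0}$ with $A_m\in\mathcal A_m$ for all $m\le 0$ and $Q\subset\bigcup_{m\le0}A_m$. Define $\Phi(Q):=\inf_{(A_m)\in\mathcal C(Q)}\sum_{m\le0}\phi_0(S^mA_m)$. The symbol $\Lambda$ also denotes the unique $S$-invariant measure on $\mathcal B$ extending $\Lambda$. ''Ergodic'' means $S$-invariant and ergodic with respect to $S$. Conventions: $0\log0:=0$, $y^x:=e^{x\log y}$ and thus $0^0:=1$, $1/\infty:=0$. For $\alpha\ge0$ and $Q\subset X$: $\mathcal H_\alpha(\Lambda,\phi_0)(Q):=\inf_{(A_m)\in\mathcal C(Q)}\sum_{m\le0}\int_{S^mA_m}Z^\alpha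 d\phi_0$ (so $\mathcal H_0=\Phi$). *)

(* Defs.v *)
From HB Require Import structures.
From mathcomp Require Export all_boot all_order all_algebra.
From mathcomp Require Export all_classical all_reals all_analysis.
From mathcomp Require Export ess_sup_inf.
Export Order.TTheory GRing.Theory Num.Theory.
Export numFieldNormedType.Exports.

Set Implicit Arguments.
Unset Strict Implicit.
Unset Printing Implicit Defensive.

Local Open Scope classical_set_scope.
Local Open Scope ring_scope.
Local Open Scope ereal_scope.

(* S^i B for an integer i. For i < 0 this is the preimage of B under S^(-i),
   which is the image of B under the inverse of S^(-i) when S is bijective, so
   no inverse function has to be named. *)
Definition spow (X : Type) (S : X -> X) (i : int) (B : set X) : set X :=
  match i with
  | Posz n => iter n S @` B
  | Negz n => iter n.+1 S @^-1` B
  end.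

Definition gen0 (X : Type) (S : X -> X) (A : set (set X)) : set (set X) :=
  \bigcup_(n in [set: nat]) [set spow S (- n%:Z)%R B | B in A].

Definition genZ (X : Type) (S : X -> X) (A : set (set X)) : set (set X) :=
  \bigcup_(i in [set: int]) [set spow S (- i)%R B | B in A].

(* X with the sigma-algebra A_0, resp. B. Both carriers are X, so a subset of X
   or a function on X can be used with either sigma-algebra. *)
Notation space0 S A := (g_sigma_algebraType (gen0 S A)).
Notation spaceZ S A := (g_sigma_algebraType (genZ S A)).

(* The sigma-algebra A_m = S^(-m) A_0, used for m <= 0. *)
Definition sigmaA (X : Type) (S : X -> X) (A : set (set X)) (m : int) :
    set (set X) :=
  [set spow S (- m)%R B | B in <<s gen0 S A >>].

(* The index m <= 0 of a sequence (A_m) is written m = - n with n : nat. *)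
Definition covers (X : Type) (S : X -> X) (A : set (set X)) (Q : set X) :
    set (nat -> set X) :=
  [set C | (forall n, sigmaA S A (- n%:Z)%R (C n)) /\ Q `<=` \bigcup_n C n].

Definition Phi (R : realType) (X : pointedType) (S : X -> X)
    (A : set (set X)) (phi0 : {measure set (space0 S A) -> \bar R})
    (Q : set X) : \bar R :=
  ereal_inf [set \sum_(0 <= n <oo) phi0 (spow S (- n%:Z)%R (C n))
            | C in covers S A Q].

Definition Hausd (R : realType) (X : pointedType) (S : X -> X)
    (A : set (set X)) (phi0 : {measure set (space0 S A) -> \bar R})
    (Z : X -> R) (alpha : R) (Q : set X) : \bar R :=
  ereal_inf
    [set \sum_(0 <= n <oo)
           \int[phi0]_(x in spow S (- n%:Z)%R (C n)) (Z x `^ alpha)%:E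
    | C in covers S A Q].

Definition invariant_measure (R : realType) d (T : measurableType d)
    (S : T -> T) (mu : {measure set T -> \bar R}) : Prop :=
  forall B, measurable B -> mu (S @^-1` B) = mu B.

Definition ergodic (R : realType) d (T : measurableType d)
    (S : T -> T) (mu : {measure set T -> \bar R}) : Prop :=
  invariant_measure S mu /\
  forall B, measurable B -> S @^-1` B = B -> mu B = 0 \/ mu (~` B) = 0.

(* Z is a version of the Radon-Nikodym derivative d nu / d mu. Here nu is only a
   set function, so that a measure on a larger sigma-algebra can be restricted
   to that of mu. *)
Definition RN_version (R : realType) d (T : measurableType d)
    (nu : set T -> \bar R) (mu : {measure set T -> \bar R}) (Z : T -> R) :
    Prop :=
  measurable_fun [set: T] Z /\
  forall B, measurable B -> nu B = \int[mu]_(x in B) (Z x)%:E.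

(* Main.v *)
(* Write T for the inverse of S and, for a finite measure w on A_0, let h_w(Q)
   be the infimum of the sums of the w(B_n) over the covers of Q by sets S^n B_n
   with B_n in A_0; Phi and H_alpha are of this form.  Always h_w(S Q) <= h_w(Q),
   so h'(Q) := sup_k h_w(S^(-k) Q) is an outer measure with h' >= h_w and
   h'(X) = h_w(X).  Every set S^m B with B in A_0 can be cut out of the members
   of index at least m of a cover, hence is Caratheodory measurable for h'.  So
   h' is a measure on the sigma-algebra B, and comparing complements gives
   h_w = h' there: h_w is a finite S-invariant measure on B, and it equals m when
   w is the restriction of an invariant measure m.

   If w <= c m on the A_0-subsets of D, cutting along the first backward hitting
   time of D gives h_w(V) <= c m(V) for V inside the union of the S^k D.  This
   union has full L_i-measure as soon as L_i(D) > 0, by ergodicity.  With D a set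
   where Z_i is close to M_i this yields the upper bound
     H_a(Q) <= a Lambda(Q) + sum_i L_i(Q) / M_i    (0 < a < 1),
   where Z^a <= a Z + 1 on {Z > 0} is used.  Distinct ergodic measures live on
   disjoint sets F_i of A_0, and Z >= lambda_i Z_i, so that for 0 <= a <= 1
     H_a(Q) >= sum_i lambda_i^a M_i^(a-1) L_i(Q).
   Hence H_a(Q) tends to sum_i L_i(Q) / M_i as a decreases to 0, which is (i).
   If phi_0 << Lambda, the upper bound also holds at a = 0, which is (ii). *)
From HB Require Import structures.
From mathcomp Require Import measurable_realfun.
Require Import Defs.

Set Implicit Arguments.
Unset Strict Implicit.
Unset Printing Implicit Defensive.

Local Open Scope classical_set_scope.
Local Open Scope ring_scope.
Local Open Scope ereal_scope.

(** * The outer measure of a one-sided cover *)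

Lemma iter_cancel (X : Type) (S T : X -> X) (n : nat) :
  cancel S T -> cancel (iter n S) (iter n T).
Proof.
by move=> SK; elim: n => // n IHn x; rewrite iterSr [X in T X]iterS SK.
Qed.

Lemma preimage_iterK (X : Type) (S T : X -> X) (n : nat) (B : set X) :
  cancel T S -> iter n T @^-1` (iter n S @^-1` B) = B.
Proof.
by move=> TK; apply/funext => x; rewrite /preimage /= (iter_cancel n TK).
Qed.

Lemma preimage_iterS (X : Type) (S : X -> X) (n : nat) (B : set X) :
  iter n.+1 S @^-1` B = S @^-1` (iter n S @^-1` B).
Proof. by apply/funext => x; rewrite /preimage /= -iterS iterSr. Qed.

Lemma preimage_iterD (X : Type) (S : X -> X) (m n : nat) (B : set X) :
  iter (m + n) S @^-1` B = iter m S @^-1` (iter n S @^-1` B).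
Proof. by apply/funext => x; rewrite /preimage /= addnC iterD. Qed.

Section tail_outer_measure.
Context d (X : measurableType d) (R : realType).
Implicit Types (S T : X -> X) (w : set X -> \bar R) (Q : set X).

Definition tail_cover T Q : set (nat -> set X) :=
  [set B | (forall n, measurable (B n)) /\
           Q `<=` \bigcup_n (iter n T @^-1` B n)].

(* With [T] the inverse of [S] and a cover [C] of the informal statement,
   [B n] is [S^(-n) (C n)], so that [iter n T @^-1` B n] is [C n]. *)
Definition tail_outer T w Q : \bar R :=
  ereal_inf [set \sum_(n <oo) w (B n) | B in tail_cover T Q].

(** When [T] is inverse to [S] these values increase with [k], so the supremum is a limit. It makes
    generators of every level Caratheodory measurable, while a single [tail_outer] only handles base
    sets directly. *)
Definition tail_limit S T w Q : \bar R :=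
  ereal_sup (range (fun k => tail_outer T w (iter k S @^-1` Q))).

(** For [T] inverse to [S], the generators are the images [S^n B] of base sets, that is, the sets
    that a cover may contain. *)
Definition tail_algebra T : set (set X) :=
  <<s \bigcup_(n in [set: nat]) [set iter n T @^-1` B | B in measurable] >>.

Lemma tail_outer_ge0 T w Q : (forall B, 0 <= w B) -> 0 <= tail_outer T w Q.
Proof.
by move=> w0; apply: le_ereal_inf_tmp => _ [B _ <-]; exact: nneseries_ge0.
Qed.

Lemma le_tail_outer T w : {homo tail_outer T w : Q Q' / Q `<=` Q' >-> Q <= Q'}.
Proof.
move=> Q Q' QQ'; apply: ereal_inf_le_tmp => _ [B [mB Q'B] <-].
by exists B => //; split => //; exact: subset_trans Q'B.
Qed.

Lemma tail_outer_preimage_iter T w n (B : set X) :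
  w set0 = 0 -> (forall A, 0 <= w A) -> measurable B ->
  tail_outer T w (iter n T @^-1` B) <= w B.
Proof.
move=> w0 wge0 mB; apply: ge_ereal_inf.
exists (\sum_(k <oo) w (if k == n then B else set0)).
  exists (fun k => if k == n then B else set0) => //; split => [k|x Bx].
    by case: ifP => // _; exact: measurable0.
  by exists n => //=; rewrite eqxx.
rewrite (nneseries_split _ n.+1)// [X in _ + X]eseries0 ?adde0; last first.
  by move=> k nk _; rewrite gtn_eqF.
rewrite big_nat_recr//= eqxx big_nat big1 ?add0e// => k /andP[_ kn].
by rewrite ltn_eqF.
Qed.

Lemma tail_outer_le T w Q : w set0 = 0 -> (forall A, 0 <= w A) ->
  measurable Q -> tail_outer T w Q <= w Q.
Proof. by move=> w0 wge0 mQ; exact: (@tail_outer_preimage_iter T w 0). Qed.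

Lemma tail_outer0 T w : w set0 = 0 -> (forall A, 0 <= w A) ->
  tail_outer T w set0 = 0.
Proof.
move=> w0 wge0; apply/eqP; rewrite eq_le tail_outer_ge0// andbT.
by rewrite -w0 tail_outer_le.
Qed.

Lemma tail_outer_fin_num T (w : {finite_measure set X -> \bar R}) Q :
  tail_outer T w Q \is a fin_num.
Proof.
rewrite ge0_fin_numE ?tail_outer_ge0//.
apply: (@le_lt_trans _ _ (w [set: X])); last first.
  by rewrite -ge0_fin_numE//; exact: fin_num_measure.
apply: (le_trans _ (tail_outer_le T _ _ measurableT)) => //.
exact: le_tail_outer.
Qed.

(** Near-optimal covers of the [F n] are merged level by level: the union over [n] of the members of
    index [k] is again a base set, so no enumeration of pairs is needed. *)
Lemma tail_outer_sigma_subadditive T (w : {finite_measure set X -> \bar R}) :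
  sigma_subadditive (tail_outer T w).
Proof.
move=> F; apply/lee_addgt0Pr => _/posnumP[e].
apply: (le_trans _ (epsilon_trick _ (fun n => tail_outer_ge0 _ _ _) _)) => //.
pose P n B := tail_cover T (F n) B /\
  \sum_(k <oo) w (B k) <= tail_outer T w (F n) + (e%:num / (2 ^ n.+1)%:R)%:E.
have [G PG] : {G : nat -> nat -> set X & forall n, P n (G n)}.
  apply: (@choice _ _ P) => n.
  have en : (0 < e%:num / (2 ^ n.+1)%:R)%R by [].
  have [_ [B cB <-] /ltW] :=
    lb_ereal_inf_adherent en (tail_outer_fin_num T w (F n)).
  by exists B.
apply: (@le_trans _ _ (\sum_(n <oo) \sum_(k <oo) w (G n k))); last first.
  apply: lee_nneseries => [n _ _|n _]; first exact: nneseries_ge0.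
  exact: (PG n).2.
have mG n k : measurable (G n k) by exact: (PG n).1.1.
rewrite nneseries_interchange//; apply: ge_ereal_inf.
exists (\sum_(k <oo) w (\bigcup_n G n k)).
  exists (fun k => \bigcup_n G n k) => //; split => [k|x [n _ Fx]].
    exact: bigcup_measurable.
  by have [k _ Gx] := (PG n).1.2 _ Fx; exists k => //; exists n.
apply: lee_nneseries => // k _; apply: measure_sigma_subadditive => //.
exact: bigcup_measurable.
Qed.

HB.instance Definition _ T (w : {finite_measure set X -> \bar R}) :=
  isOuterMeasure.Build R X (tail_outer T w)
    (tail_outer0 T (measure0 w) (measure_ge0 w))
    (fun Q => tail_outer_ge0 T Q (measure_ge0 w))
    (@le_tail_outer T w) (tail_outer_sigma_subadditive T w).

Section tail_limit.
Variables (S T : X -> X) (w : {finite_measure set X -> \bar R}).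
Let h := tail_outer T w.
Let hinf := tail_limit S T w.

Lemma tail_outer_le_limit k Q : h (iter k S @^-1` Q) <= hinf Q.
Proof. by apply: ereal_sup_ubound; exists k. Qed.

Lemma tail_limit0 : hinf set0 = 0.
Proof.
apply/eqP; rewrite eq_le; apply/andP; split.
  apply: ge_ereal_sup => _ [k _ <-].
  by rewrite preimage_set0 outer_measure0.
by apply: (le_trans _ (tail_outer_le_limit 0 _)); exact: outer_measure_ge0.
Qed.

Lemma tail_limit_ge0 Q : 0 <= hinf Q.
Proof.
by apply: (le_trans _ (tail_outer_le_limit 0 _)); exact: outer_measure_ge0.
Qed.

Lemma le_tail_limit : {homo hinf : Q Q' / Q `<=` Q' >-> Q <= Q'}.
Proof.
move=> Q Q' QQ'; apply: ge_ereal_sup => _ [k _ <-].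
apply: (le_trans _ (tail_outer_le_limit k _)).
by apply: le_tail_outer => x; exact: QQ'.
Qed.

Lemma tail_limit_sigma_subadditive : sigma_subadditive hinf.
Proof.
move=> F; apply: ge_ereal_sup => _ [k _ <-].
rewrite preimage_bigcup (le_trans (outer_measure_sigma_subadditive _ _))//.
apply: lee_nneseries => n _; first by move=> _; exact: outer_measure_ge0.
exact: tail_outer_le_limit.
Qed.

End tail_limit.

HB.instance Definition _ S T (w : {finite_measure set X -> \bar R}) :=
  isOuterMeasure.Build R X (tail_limit S T w)
    (tail_limit0 S T w) (tail_limit_ge0 S T w) (@le_tail_limit S T w)
    (tail_limit_sigma_subadditive S T w).

Section invertible.
Variables (S T : X -> X) (w : {finite_measure set X -> \bar R}).
Hypotheses (SK : cancel S T) (TK : cancel T S).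
Hypothesis mS : measurable_fun [set: X] S.
Let h := tail_outer T w.
Let hinf := tail_limit S T w.

Lemma measurable_preimage_iter n (B : set X) :
  measurable B -> measurable (iter n S @^-1` B).
Proof.
move=> mB; elim: n => // n IHn.
rewrite preimage_iterS -[X in measurable X]setTI.
exact: mS.
Qed.

(** A cover of the preimage becomes a cover of [Q] when every index is raised by one; the vacated
    index 0 receives the empty set. *)
Lemma tail_outer_preimage_le Q : h Q <= h (S @^-1` Q).
Proof.
apply: ereal_inf_le_tmp => _ [B [mB SQB] <-].
exists (fun n => if n is n'.+1 then B n' else set0).
  split => [[|n]//|x Qx]; have [n _ Bx] : (\bigcup_n (iter n T @^-1` B n)) (T x).
    by apply: SQB; rewrite /preimage/= TK.
  by exists n.+1 => //; rewrite /preimage/= -iterS iterSr.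
rewrite nneseries_recl ?measure0 ?add0e//.
rewrite -(nneseries_addn 1) => [|[|n]//].
by apply: eq_eseriesr => n _; rewrite addn1.
Qed.

Lemma tail_outer_nondecreasing Q :
  nondecreasing_seq (fun k => h (iter k S @^-1` Q)).
Proof.
apply/nondecreasing_seqP => k.
by rewrite preimage_iterS; exact: tail_outer_preimage_le.
Qed.

Lemma tail_limit_setT : hinf [set: X] = h [set: X].
Proof.
apply/eqP; rewrite eq_le; apply/andP; split.
  by apply: ge_ereal_sup => _ [k _ <-]; rewrite preimage_setT.
exact: (tail_outer_le_limit S T w 0).
Qed.

(** Cutting the covering set [S^n B_n] by [U] amounts to cutting [B_n] by the preimage of [U] under
    [S^n]. This is a base set, so both halves of the cover are admissible. *)
Lemma tail_outer_caratheodory U Q : measurable U ->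
  h (Q `&` U) + h (Q `&` ~` U) <= h Q.
Proof.
move=> mU; apply: le_ereal_inf_tmp => _ [B [mB QB] <-].
have mBU n : measurable (B n `&` iter n S @^-1` U).
  by apply: measurableI => //; exact: measurable_preimage_iter.
have mBD n : measurable (B n `&` ~` (iter n S @^-1` U)).
  apply: measurableI => //; apply: measurableC.
  exact: measurable_preimage_iter.
have iterK n := iter_cancel n TK.
rewrite [leRHS](_ : _ = \sum_(n <oo) (w (B n `&` iter n S @^-1` U) +
    w (B n `&` ~` (iter n S @^-1` U)))); last first.
  apply: eq_eseriesr => n _.
  rewrite -measureU//; first by rewrite -setIUr setUv setIT.
  by rewrite setIACA setICr setI0.
rewrite nneseriesD//; apply: leeD; apply: ereal_inf_lbound.
  exists (fun n => B n `&` iter n S @^-1` U) => //; split => // x [Qx Ux].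
  by have [n _ Bx] := QB _ Qx; exists n => //; split; rewrite //= iterK.
exists (fun n => B n `&` ~` (iter n S @^-1` U)) => //; split => // x [Qx Ux].
by have [n _ Bx] := QB _ Qx; exists n => //; split; rewrite //= iterK.
Qed.

(** A generator of level [m] becomes a base set once pulled back at least [m] times, so the
    splitting inequality holds at all late levels and passes to the limit. *)
Lemma tail_limit_caratheodory Q : tail_algebra T Q -> hinf.-caratheodory Q.
Proof.
apply: smallest_sub.
  by split => [|A mA|F mF]; [exact: caratheodory_measurable_set0|
    rewrite setTD; exact: caratheodory_measurable_setC|
    exact: caratheodory_measurable_bigcup].
move=> _ [m _ [B mB <-]]; apply: le_caratheodory_measurable => Y.
set U := iter m T @^-1` B.
have hfin k V : h (iter k S @^-1` V) \is a fin_num by exact: tail_outer_fin_num.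
have hUD j k : h (iter j S @^-1` (Y `&` U)) + h (iter k S @^-1` (Y `&` ~` U))
    <= hinf Y.
  (* A level past [m] makes the pullback of [U] a base set; being past [j] and [k] lets monotonicity
     treat the two suprema independently. *)
  pose n := maxn m (maxn j k).
  apply: (le_trans _ (tail_outer_le_limit S T w n Y)).
  have mn : (m <= n)%N by rewrite leq_maxl.
  have mU : measurable (iter n S @^-1` U).
    rewrite -(subnK mn) preimage_iterD preimage_iterK//.
    exact: measurable_preimage_iter.
  apply: (le_trans _ (tail_outer_caratheodory _ mU)).
  rewrite preimage_setC -!preimage_setI; apply: leeD;
    by apply: tail_outer_nondecreasing; rewrite !leq_max leqnn !orbT.
rewrite /hinf.
have hD k : hinf (Y `&` U) + h (iter k S @^-1` (Y `&` ~` U)) <= hinf Y.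
  rewrite -leeBrDr//; apply: ge_ereal_sup => _ [j _ <-].
  by rewrite leeBrDr.
have Yfin : hinf (Y `&` U) \is a fin_num.
  rewrite ge0_fin_numE; last exact: tail_limit_ge0.
  apply: (@le_lt_trans _ _ (hinf [set: X])); first exact: le_tail_limit.
  rewrite tail_limit_setT -ge0_fin_numE; first exact: tail_outer_fin_num.
  exact: outer_measure_ge0.
(* The second supremum is taken only after the first; finiteness of the other summand permits the
   subtraction. *)
rewrite addeC -leeBrDr//; apply: ge_ereal_sup => _ [k _ <-].
by rewrite leeBrDr// addeC.
Qed.

Lemma tail_algebraC Q : tail_algebra T Q -> tail_algebra T (~` Q).
Proof.
have [_ + _] := smallest_sigma_algebra [set: X]
  (\bigcup_(n in [set: nat]) [set iter n T @^-1` B | B in @measurable _ X]).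
by move=> /[apply]; rewrite setTD.
Qed.

(* The two outer measures have the same total mass, and the larger one is
   additive on the sigma-algebra. *)
Lemma tail_outer_eq_limit Q : tail_algebra T Q -> h Q = hinf Q.
Proof.
move=> mQ; apply/eqP; rewrite eq_le (tail_outer_le_limit S T w 0)/=.
have hC : h (~` Q) \is a fin_num by exact: tail_outer_fin_num.
have hQ : h Q \is a fin_num by exact: tail_outer_fin_num.
have le1 : hinf Q + hinf (~` Q) <= h Q + h (~` Q).
  have -> : hinf Q + hinf (~` Q) = hinf [set: X].
    by rewrite (tail_limit_caratheodory mQ [set: X]) !setTI.
  by rewrite tail_limit_setT -(setUv Q); exact: outer_measureU2.
rewrite -(leeD2rE _ _ hC) (le_trans _ le1)// leeD2l//.
exact: (tail_outer_le_limit S T w 0).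
Qed.

Lemma tail_outer_setIC Q U : tail_algebra T Q -> tail_algebra T U ->
  h Q = h (Q `&` U) + h (Q `&` ~` U).
Proof.
move=> mQ mU; have mI V : tail_algebra T V -> tail_algebra T (Q `&` V).
  move=> mV; pose Y := g_sigma_algebraType
    (\bigcup_(n in [set: nat]) [set iter n T @^-1` B | B in @measurable _ X]).
  exact: (@measurableI _ Y).
have mD : tail_algebra T (Q `&` ~` U) by apply: mI; exact: tail_algebraC.
rewrite (tail_outer_eq_limit mQ) (tail_outer_eq_limit mD).
rewrite (tail_outer_eq_limit (mI _ mU)).
exact: tail_limit_caratheodory.
Qed.

(** The increasing sequence of values on preimages already starts at its limit [hinf Q], so it is
    constant. *)
Lemma tail_outer_shift Q : tail_algebra T Q -> tail_algebra T (S @^-1` Q) ->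
  h (S @^-1` Q) = h Q.
Proof.
move=> mQ mSQ; apply/eqP; rewrite eq_le tail_outer_preimage_le andbT.
rewrite [leRHS]tail_outer_eq_limit//; exact: (tail_outer_le_limit S T w 1).
Qed.

End invertible.
End tail_outer_measure.

(** * Ergodicity and the two sigma-algebras *)

Section ergodicity.
Context d (X : measurableType d) (R : realType).
Variables (S : X -> X) (mu : {finite_measure set X -> \bar R}).
Hypotheses (mS : measurable_fun [set: X] S) (erg : ergodic S mu).

(** Ergodicity speaks of strictly invariant sets. The upper limit of the preimages of [P] is
    strictly invariant and differs from [P] by a null set. *)
Lemma ergodic_quasi_invariant (P : set X) : measurable P ->
  mu (P `\` S @^-1` P) = 0 -> mu P = 0 \/ mu (~` P) = 0.
Proof.
move=> mP PS0; have [inv ergS] := erg.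
have mpre B : measurable B -> measurable (S @^-1` B).
  by move=> mB; rewrite -[X in measurable X]setTI; exact: mS.
(* [P] and its preimage have the same finite mass, so one difference is null as soon as the other
   is. *)
have SP0 : mu (S @^-1` P `\` P) = 0.
  have mSP := mpre _ mP; have mI : measurable (P `&` S @^-1` P).
    exact: measurableI.
  have e1 : mu P = mu (P `&` S @^-1` P).
    by rewrite -[RHS]add0e -PS0; exact: measureDI.
  have e2 : mu P = mu (S @^-1` P `\` P) + mu (P `&` S @^-1` P).
    by rewrite -(inv _ mP) setIC; exact: measureDI.
  have Ifin : mu (P `&` S @^-1` P) \is a fin_num by exact: fin_num_measure.
  apply/eqP; rewrite eq_le measure_ge0 andbT -(leeD2rE _ _ Ifin) add0e -e2.
  by rewrite -e1.
pose D n := iter n S @^-1` P.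
have mD n : measurable (D n) by exact: measurable_preimage_iter.
have DP0 n : mu (D n `\` P) = 0.
  elim: n => [|n IHn]; first by rewrite /D/= setDv measure0.
  apply: (@subset_measure0 _ _ _ mu _
      (S @^-1` (D n `\` P) `|` (S @^-1` P `\` P))).
  - exact: measurableD.
  - by apply: measurableU; [apply: mpre; exact: measurableD|
      apply: measurableD => //; exact: mpre].
  - rewrite /D preimage_iterS => x [Dx Px].
    by have [PSx|PSx] := pselect (P (S x)); [right|left].
  - apply: null_set_setU => //; [by apply: mpre; exact: measurableD|
      by apply: measurableD => //; exact: mpre|].
    by rewrite inv//; exact: measurableD.
have PD0 n : mu (P `\` D n) = 0.
  elim: n => [|n IHn]; first by rewrite /D/= setDv measure0.
  apply: (@subset_measure0 _ _ _ mu _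
      (S @^-1` (P `\` D n) `|` (P `\` S @^-1` P))).
  - exact: measurableD.
  - by apply: measurableU; [apply: mpre; exact: measurableD|
      apply: measurableD => //; exact: mpre].
  - rewrite /D preimage_iterS => x [Px Dx].
    by have [PSx|PSx] := pselect (P (S x)); [left|right].
  - apply: null_set_setU => //; [by apply: mpre; exact: measurableD|
      by apply: measurableD => //; exact: mpre|].
    by rewrite inv//; exact: measurableD.
pose E := \bigcap_m \bigcup_(n in [set n | (m <= n)%N]) D n.
have mE : measurable E.
  apply: bigcap_measurable => // m _; apply: bigcup_measurable => //.
have SE : S @^-1` E = E.
  apply/seteqP; split=> x Ex m _.
    have [n /= mn Dx] := Ex m I; exists n.+1; first exact: leqW.
    by rewrite /D preimage_iterS.
  have [[//|n] /= mn Dx] := Ex m.+1 I; exists n => //.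
  by move: Dx; rewrite /D preimage_iterS.
have EP0 : mu (E `\` P) = 0.
  apply: (@subset_measure0 _ _ _ mu _ (\bigcup_n (D n `\` P))).
  - exact: measurableD.
  - by apply: bigcup_measurable => n _; exact: measurableD.
  - by move=> x [/(_ 0%N I)[n _ Dx] Px]; exists n.
  - apply/negligibleP; first by apply: bigcup_measurable => n _; exact: measurableD.
    apply: negligible_bigcup => n; apply/negligibleP; last exact: DP0.
    exact: measurableD.
have PE0 : mu (P `\` E) = 0.
  apply: (@subset_measure0 _ _ _ mu _ (\bigcup_n (P `\` D n))).
  - exact: measurableD.
  - by apply: bigcup_measurable => n _; exact: measurableD.
  - move=> x [Px /existsNP[m /not_implyP[_ Dx]]]; exists m => //; split => // Dmx.
    by apply: Dx; exists m => /=.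
  - apply/negligibleP; first by apply: bigcup_measurable => n _; exact: measurableD.
    apply: negligible_bigcup => n; apply/negligibleP; last exact: PD0.
    exact: measurableD.
have [E0|EC0] := ergS _ mE SE; [left|right].
  apply: (@subset_measure0 _ _ _ mu _ ((P `\` E) `|` E)) => //.
  - by apply: measurableU => //; exact: measurableD.
  - by move=> x Px; have [|] := pselect (E x); [right|left].
  - by apply: null_set_setU => //; exact: measurableD.
apply: (@subset_measure0 _ _ _ mu _ ((E `\` P) `|` ~` E)) => //.
- exact: measurableC.
- by apply: measurableU; [exact: measurableD|exact: measurableC].
- by move=> x Px; have [|] := pselect (E x); [left|right].
- by apply: null_set_setU => //; [exact: measurableD|exact: measurableC].
Qed.

(** The union of the [S^k D] is contained in its own preimage under [S], and it contains [D], so it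
    cannot be the null alternative. *)
Lemma ergodic_sweep (T : X -> X) (D : set X) : cancel S T ->
  measurable_fun [set: X] T -> measurable D -> mu D != 0 ->
  mu (~` \bigcup_k (iter k T @^-1` D)) = 0.
Proof.
move=> SK mT mD D0; set E := \bigcup_k _.
have mE : measurable E.
  by apply: bigcup_measurable => k _; exact: measurable_preimage_iter.
have [||//] := ergodic_quasi_invariant mE.
  rewrite (_ : _ `\` _ = set0) ?measure0//; apply/seteqP; split => // x [[k _ Dx]].
  by apply; exists k.+1 => //; rewrite /preimage/= -iterS iterSr SK.
move=> E0; move: D0; rewrite (@subset_measure0 _ _ _ mu D E) ?eqxx//.
by move=> x Dx; exists 0%N.
Qed.

End ergodicity.

(** * The one-sided and the two-sided sigma-algebra *)

Section natural_extension.
Context (X : pointedType).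
Variables (S T : X -> X) (A : set (set X)).
Hypotheses (SK : cancel S T) (TK : cancel T S).
Let X0 := space0 S A.
Let XZ := spaceZ S A.

Lemma spow_opp n (B : set X) : spow S (- n%:Z)%R B = iter n S @^-1` B.
Proof. by case: n => //=; rewrite image_id. Qed.

Lemma image_iterE n (B : set X) : iter n S @` B = iter n T @^-1` B.
Proof.
apply/seteqP; split => [_ [x Bx <-]|x Tx].
  by rewrite /preimage/= (iter_cancel n SK).
by exists (iter n T x) => //; rewrite (iter_cancel n TK).
Qed.

Lemma spow_preimage i (B : set X) : S @^-1` (spow S i B) = spow S (i - 1)%R B.
Proof.
case: i => [[|n]|n].
- by rewrite sub0r (spow_opp 1%N)/= image_id.
- rewrite -addn1 PoszD addrK /= !image_iterE addn1 preimage_iterS.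
  by rewrite (preimage_iterK 1%N _ SK).
- by rewrite NegzE -opprD -(PoszD _ 1%N) addn1 !spow_opp -preimage_iterS.
Qed.

Lemma spow_preimage_inv i (B : set X) :
  T @^-1` (spow S i B) = spow S (i + 1)%R B.
Proof.
by rewrite -[in LHS](addrK 1%R i) -spow_preimage (preimage_iterK 1%N _ TK).
Qed.

Lemma gen0_genZ : gen0 S A `<=` genZ S A.
Proof. by move=> _ [n _ [B AB <-]]; exists n%:Z => //; exists B. Qed.

Lemma measurable_space0_spaceZ (B : set X) :
  measurable (B : set X0) -> measurable (B : set XZ).
Proof. by move: B; apply: sub_sigma_algebra2; exact: gen0_genZ. Qed.

Lemma measurable_shift0 : measurable_fun [set: X0] (S : X0 -> X0).
Proof.
apply: (@measurability _ _ X0 X0 setT S (gen0 S A)) => //.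
move=> _ [_ [n _ [B AB <-]] <-]; apply: sub_sigma_algebra; rewrite setTI.
by exists n.+1 => //; exists B; rewrite // !spow_opp preimage_iterS.
Qed.

Lemma measurable_shiftZ : measurable_fun [set: XZ] (S : XZ -> XZ).
Proof.
apply: (@measurability _ _ XZ XZ setT _ (genZ S A)) => //.
move=> _ [_ [i _ [B AB <-]] <-]; apply: sub_sigma_algebra; rewrite setTI.
by exists (i + 1)%R => //; exists B; rewrite // spow_preimage opprD.
Qed.

Lemma measurable_shiftZ_inv : measurable_fun [set: XZ] (T : XZ -> XZ).
Proof.
apply: (@measurability _ _ XZ XZ setT _ (genZ S A)) => //.
move=> _ [_ [i _ [B AB <-]] <-]; apply: sub_sigma_algebra; rewrite setTI.
by exists (i - 1)%R => //; exists B; rewrite // spow_preimage_inv opprB addrC.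
Qed.

(** A preimage of a set of [A] under a nonnegative power of [S] is already a base set, hence of
    level 0; an image under [S^(n+1)] is of level [n+1]. *)
Lemma spaceZ_tail_algebra (B : set X) :
  measurable (B : set XZ) -> tail_algebra (T : X0 -> X0) B.
Proof.
move: B; apply: sub_sigma_algebra2 => _ [i _ [C AC <-]]; case: i => n.
  exists 0%N => //; exists (spow S (- n%:Z)%R C) => //.
  by apply: sub_sigma_algebra; exists n => //; exists C.
exists n.+1 => //; exists C; last by rewrite NegzE opprK -image_iterE.
by apply: sub_sigma_algebra; exists 0%N => //; exists C; rewrite // (spow_opp 0%N).
Qed.

End natural_extension.

(** * Sweeping by backward hitting times *)

(** The function is unchanged; the new name carries the measure structure for the smaller
    sigma-algebra. *)
Definition base_restriction (R : realType) (X : pointedType) (S : X -> X)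
  (A : set (set X)) (m : set (spaceZ S A) -> \bar R) :
    set (space0 S A) -> \bar R := m.

Section base_restriction.
Context (R : realType) (X : pointedType) (S : X -> X) (A : set (set X)).
Variable m : {finite_measure set (spaceZ S A) -> \bar R}.

Let restr0 : base_restriction m set0 = 0. Proof. exact: measure0. Qed.

Let restr_ge0 B : 0 <= base_restriction m B. Proof. exact: measure_ge0. Qed.

Let restr_sigma_additive : semi_sigma_additive (base_restriction m).
Proof.
move=> F mF tF mUF; apply: (@measure_semi_sigma_additive _ _ _ m F) => //.
- by move=> n; exact: measurable_space0_spaceZ.
- exact: measurable_space0_spaceZ.
Qed.

HB.instance Definition _ := isMeasure.Build _ _ _ (base_restriction m)
  restr0 restr_ge0 restr_sigma_additive.

Let restr_fin : fin_num_fun (base_restriction m).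
Proof. by move=> B mB; apply: fin_num_measure; exact: measurable_space0_spaceZ. Qed.

HB.instance Definition _ :=
  Measure_isFinite.Build _ _ _ (base_restriction m) restr_fin.

End base_restriction.

Section sweep.
Context (R : realType) (X : pointedType).
Variables (S T : X -> X) (A : set (set X)).
Hypotheses (SK : cancel S T) (TK : cancel T S).
Let X0 := space0 S A.
Let XZ := spaceZ S A.

Let mS0 := measurable_shift0 (S := S) (A := A).
Let mSZ := measurable_shiftZ SK TK (A := A).
Let mTZ := measurable_shiftZ_inv SK TK (A := A).
Let tailZ (B : set X) (mB : measurable (B : set XZ)) :=
  spaceZ_tail_algebra SK TK mB.

Lemma measurableZ_iter n (B : set XZ) :
  measurable B -> measurable (iter n S @^-1` B : set XZ).
Proof. exact: measurable_preimage_iter. Qed.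

Lemma measurableZ_iter_inv n (B : set XZ) :
  measurable B -> measurable (iter n T @^-1` B : set XZ).
Proof. exact: measurable_preimage_iter. Qed.

Lemma invariant_preimage_iter (m : {finite_measure set XZ -> \bar R}) n
    (B : set XZ) :
  invariant_measure (S : XZ -> XZ) m -> measurable B ->
  m (iter n S @^-1` B) = m B.
Proof.
move=> inv mB; elim: n => // n IHn; rewrite preimage_iterS -IHn.
by apply: inv; exact: measurableZ_iter.
Qed.

Lemma invariant_preimage_iter_inv (m : {finite_measure set XZ -> \bar R}) n
    (B : set XZ) :
  invariant_measure (S : XZ -> XZ) m -> measurable B ->
  m (iter n T @^-1` B) = m B.
Proof.
move=> inv mB; rewrite -[in RHS](preimage_iterK n B SK).
by rewrite invariant_preimage_iter//; exact: measurableZ_iter_inv.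
Qed.

(** By invariance the cost of a cover is the sum of the masses of the covering sets themselves, so
    countable subadditivity applies. *)
Lemma tail_outer_restriction_ge (m : {finite_measure set XZ -> \bar R})
    (Q : set XZ) :
  invariant_measure (S : XZ -> XZ) m -> measurable Q ->
  m Q <= tail_outer (T : X0 -> X0) (base_restriction m) Q.
Proof.
move=> inv mQ; apply: le_ereal_inf_tmp => _ [B [mB QB] <-].
have mBZ n : measurable (iter n T @^-1` B n : set XZ).
  by apply: measurableZ_iter_inv; exact: measurable_space0_spaceZ.
rewrite [leRHS](_ : _ = \sum_(n <oo) m (iter n T @^-1` B n)); last first.
  apply: eq_eseriesr => n _; rewrite invariant_preimage_iter_inv//.
  exact: measurable_space0_spaceZ.
exact: measure_sigma_subadditive.
Qed.

(** The reverse inequality for the complement of [Q], additivity of [h], and the bound of the total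
    value of [h] by [m X] leave no room for a larger value. *)
Lemma tail_outer_restriction_le (m : {finite_measure set XZ -> \bar R})
    (Q : set XZ) :
  invariant_measure (S : XZ -> XZ) m -> measurable Q ->
  tail_outer (T : X0 -> X0) (base_restriction m) Q <= m Q.
Proof.
move=> inv mQ; set h := tail_outer _ _.
have hC : h (~` Q) \is a fin_num by exact: tail_outer_fin_num.
rewrite -(leeD2rE _ _ hC); apply: (@le_trans _ _ (h [set: XZ])).
  have := tail_outer_setIC (base_restriction m) SK TK mS0
    (tailZ measurableT) (tailZ mQ).
  by rewrite !setTI => <-.
apply: (@le_trans _ _ (m [set: XZ])).
  apply: tail_outer_le => //; exact: measure0.
rewrite -(setUv Q) measureU ?setICr//; last exact: measurableC.
by rewrite leeD2l// tail_outer_restriction_ge//; exact: measurableC.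
Qed.

(** Each invariant measure is recovered from its base restriction as an infimum over covers, and
    that infimum is monotone in the restriction. *)
Lemma invariant_extension_le (m1 m2 : {finite_measure set XZ -> \bar R}) :
  invariant_measure (S : XZ -> XZ) m1 -> invariant_measure (S : XZ -> XZ) m2 ->
  (forall B : set X0, measurable B -> m1 B <= m2 B) ->
  forall Q : set XZ, measurable Q -> m1 Q <= m2 Q.
Proof.
move=> inv1 inv2 m12 Q mQ.
apply: le_trans (tail_outer_restriction_ge inv1 mQ) _.
apply: le_trans (tail_outer_restriction_le inv2 mQ).
apply: le_ereal_inf_tmp => _ [B [mB QB] <-].
apply: ge_ereal_inf; exists (\sum_(n <oo) m1 (B n)); first by exists B.
apply: lee_nneseries => n _; first by move=> _; exact: measure_ge0.
exact: m12.
Qed.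

Lemma tail_outer_preimage_inv (w : {finite_measure set X0 -> \bar R}) n
    (Q : set XZ) :
  measurable Q -> tail_outer (T : X0 -> X0) w (iter n T @^-1` Q) =
                  tail_outer (T : X0 -> X0) w Q.
Proof.
move=> mQ; elim: n => // n IHn; rewrite -IHn preimage_iterS.
have mQn : measurable (iter n T @^-1` Q : set XZ) by exact: measurableZ_iter_inv.
have mQn1 : measurable (T @^-1` (iter n T @^-1` Q) : set XZ).
  exact: (@measurableZ_iter_inv 1%N).
have := tail_outer_shift w SK TK mS0 (tailZ mQn1).
rewrite (preimage_iterK 1%N _ SK) => -> //; exact: tailZ.
Qed.

Variables (w : {finite_measure set X0 -> \bar R})
  (m : {finite_measure set XZ -> \bar R}) (D : set X0) (c : R).
Hypotheses (inv : invariant_measure (S : XZ -> XZ) m) (mD : measurable D).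
Hypotheses (c_gt0 : (0 < c)%R)
  (wm : forall B : set X0, measurable B -> B `<=` D -> w B <= c%:E * m B).

Let h := tail_outer (T : X0 -> X0) w.
Let E : set XZ := \bigcup_k (iter k T @^-1` D).

Let mDZ : measurable (D : set XZ).
Proof. exact: measurable_space0_spaceZ. Qed.

Let mE : measurable E.
Proof.
by apply: bigcup_measurable => k _; exact: measurableZ_iter_inv.
Qed.

(* Split according to the first [k] with [T^k x] in [D]: the piece number [k]
   is moved into [D] by [S^(-k)], and the result still belongs to the smallest
   sigma-algebra. *)
Let sweep_base (B : set X0) : measurable B -> h (B `&` E) <= c%:E * m B.
Proof.
move=> mB; pose F k : set X := iter k T @^-1` D.
pose V k : set X := B `&` (F k `\` \bigcup_(j in `I_k) F j).
(* Pulling back by [S^k] turns all hitting conditions up to time [k] into forward ones, which are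
   base sets. *)
have shiftF k j : (j <= k)%N -> iter k S @^-1` F j = iter (k - j) S @^-1` D.
  by move=> jk; rewrite /F -{1}(subnK jk) preimage_iterD preimage_iterK.
have mF k j : (j <= k)%N -> measurable (iter k S @^-1` F j : set X0).
  by move=> jk; rewrite shiftF//; exact: measurable_preimage_iter.
have mSV k : measurable (iter k S @^-1` V k : set X0).
  rewrite /V setDE !preimage_setI -preimage_setC preimage_bigcup -setDE.
  apply: measurableI.
    exact: measurable_preimage_iter.
  apply: measurableD; first exact: mF.
  by apply: bigcup_measurable => j /= /ltnW; exact: mF.
have mV k : measurable (V k : set XZ).
  rewrite -(preimage_iterK k (V k) TK); apply: measurableZ_iter_inv.
  exact: measurable_space0_spaceZ.
have SVD k : iter k S @^-1` V k `<=` D.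
  move=> x [_ [Fx _]]; move: Fx.
  by rewrite /F/preimage/= (iter_cancel k SK).
have hV k : h (V k) <= c%:E * m (V k).
  rewrite -[in leLHS](preimage_iterK k (V k) TK).
  apply: le_trans (tail_outer_preimage_iter _ _ _ _ (mSV k)) _ => //.
  rewrite -(invariant_preimage_iter k inv (mV k)).
  exact: wm.
have BE : B `&` E = \bigcup_k V k.
  apply/seteqP; split=> [x [Bx [k0 _ Fx]]|x [k _ [Bx [Fx _]]]]; last first.
    by split => //; exists k.
  have exF : exists k, `[< F k x >] by exists k0; exact/asboolP.
  case: (ex_minnP exF) => k /asboolP Fkx kmin; exists k => //; split => //.
  by split => // -[j /= jk /asboolP /kmin]; rewrite leqNgt jk.
rewrite BE; apply: le_trans (outer_measure_sigma_subadditive _ _) _.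
apply: (@le_trans _ _ (\sum_(k <oo) c%:E * m (V k))).
  by apply: lee_nneseries => k _; [move=> _; exact: outer_measure_ge0|exact: hV].
rewrite nneseriesZl//.
apply: lee_wpmul2l; first by rewrite lee_fin ltW.
have tV : trivIset setT V.
  apply/trivIsetP => i j _ _; wlog ij : i j / (i < j)%N => [W|_].
    rewrite neq_ltn => /orP[ij|ji]; first by apply: W => //; rewrite ltn_eqF.
    by rewrite setIC; apply: W => //; rewrite ltn_eqF.
  by apply/seteqP; split => // x [[_ [Fx _]] [_ [_]]]; apply; exists i.
have <- : m (\bigcup_k V k) = \sum_(k <oo) m (V k).
  rewrite measure_bigcup//; first by apply: eq_eseriesl => k; rewrite in_setT.
rewrite -BE; apply: le_measure; rewrite ?inE//.
- by apply: measurableI => //; exact: measurable_space0_spaceZ.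
- exact: measurable_space0_spaceZ.
Qed.

(** The image of [E] under [S^n] lies in [E] and has the same finite [h]-value, so the rest of [E]
    is [h]-null. Inside that image the set is the shift of [B] intersected with [E], and [h] is
    shift invariant. *)
Let sweep_level n (B : set X0) : measurable B ->
  h (iter n T @^-1` B `&` E) <= c%:E * m B.
Proof.
move=> mB; have mBZ := measurable_space0_spaceZ mB.
pose En : set XZ := iter n T @^-1` E.
have mEn : measurable En by exact: measurableZ_iter_inv.
have EnE : En `<=` E.
  by move=> x [k _ Dx]; exists (k + n)%N => //; rewrite /preimage/= iterD.
have EEn0 : h (E `&` ~` En) = 0.
  have := tail_outer_setIC w SK TK mS0 (tailZ mE) (tailZ mEn).
  rewrite -[in LHS](tail_outer_preimage_inv w n mE) (setIidr EnE) -/En -/h.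
  have En_fin : h En \is a fin_num by exact: tail_outer_fin_num.
  move=> e; apply/eqP; rewrite eq_le outer_measure_ge0 andbT.
  by rewrite -(leeD2lE _ _ En_fin) adde0 -e.
apply: (@le_trans _ _ (h (iter n T @^-1` (B `&` E) `|` (E `&` ~` En)))).
  apply: le_tail_outer => x [Bx Ex].
  by have [Enx|Enx] := pselect (En x); [left|right].
have hU (P Q : set X) : h (P `|` Q) <= h P + h Q by exact: outer_measureU2.
apply: le_trans (hU _ _) _; rewrite EEn0 adde0.
rewrite [leLHS]tail_outer_preimage_inv; first exact: sweep_base.
exact: measurableI.
Qed.

(** Since [m Q] bounds the infimum of the costs for [m] from above, it suffices to estimate the
    members of an arbitrary cover one by one. *)
Lemma tail_outer_sweep (Q : set XZ) : measurable Q ->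
  h (Q `&` E) <= c%:E * m Q.
Proof.
move=> mQ; rewrite -lee_pdivrMl//.
apply: le_trans (tail_outer_restriction_le inv mQ).
apply: le_ereal_inf_tmp => _ [B [mB QB] <-].
rewrite lee_pdivrMl// -nneseriesZl//.
apply: (@le_trans _ _ (h (\bigcup_n (iter n T @^-1` B n `&` E)))).
  by apply: le_tail_outer => x [/QB[n _ Bx] Ex]; exists n.
apply: le_trans (outer_measure_sigma_subadditive _ _) _.
apply: lee_nneseries => n _; first by move=> _; exact: outer_measure_ge0.
exact: sweep_level.
Qed.

End sweep.

(** * Densities and mutual singularity *)

Section densities.
Context d (X : measurableType d) (R : realType).
Variable phi : {measure set X -> \bar R}.

Lemma measurable_funTS_EFin (f : X -> R) (B : set X) :
  measurable_fun [set: X] f -> measurable_fun B (fun x => (f x)%:E).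
Proof. by move=> mf; apply/measurable_EFinP; exact: measurable_funTS. Qed.

Lemma measurable_set_ltr (f g : X -> R) : measurable_fun [set: X] f ->
  measurable_fun [set: X] g -> measurable [set x | (f x < g x)%R].
Proof.
move=> mf mg; rewrite -[X in measurable X]setTI.
exact: (measurable_fun_ltr mf mg measurableT (Y := [set true])).
Qed.

Lemma integral_pos_null (f : X -> R) (B : set X) : measurable B ->
  measurable_fun [set: X] f -> (forall x, B x -> (0 < f x)%R) ->
  \int[phi]_(x in B) (f x)%:E = 0 -> phi B = 0.
Proof.
move=> mB mf f0 intf.
have mfE := measurable_funTS_EFin (B := B) mf.
have /(ae_eq_integral_abs phi mB mfE) : \int[phi]_(x in B) `|(f x)%:E| = 0.
  rewrite -[RHS]intf; apply: eq_integral => x /set_mem Bx.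
  by rewrite /= gtr0_norm ?f0.
move=> ae0; apply/(negligibleP phi mB); apply: negligibleS ae0 => x Bx /= /(_ Bx).
by move=> [fx0]; have := f0 _ Bx; rewrite fx0 ltxx.
Qed.

Lemma strict_density_null (f g : X -> R) (B : set X) : measurable B ->
  measurable_fun [set: X] f -> measurable_fun [set: X] g ->
  (forall x, B x -> (0 <= f x < g x)%R) ->
  \int[phi]_(x in B) (f x)%:E \is a fin_num ->
  \int[phi]_(x in B) (g x)%:E <= \int[phi]_(x in B) (f x)%:E -> phi B = 0.
Proof.
move=> mB mf mg fg fin gf.
have mE h := @measurable_funTS_EFin h B.
apply: (@integral_pos_null (g \- f)%R) => //; first exact: measurable_funB.
  by move=> x /fg/andP[_]; rewrite /= subr_gt0.
apply/eqP; rewrite eq_le; apply/andP; split; last first.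
  by apply: integral_ge0 => x /fg/andP[_ /ltW]; rewrite lee_fin/= subr_ge0.
rewrite -(leeD2lE _ _ fin) adde0 -ge0_integralD//; last 4 first.
- by move=> x /fg/andP[].
- exact: mE.
- by move=> x /fg/andP[_ /ltW]; rewrite lee_fin/= subr_ge0.
- by apply: mE; exact: measurable_funB.
apply: le_trans gf; rewrite le_eqVlt; apply/orP; left; apply/eqP.
by apply: eq_integral => x _; rewrite -EFinD/= addrC subrK.
Qed.

Variable nu : set X -> \bar R.

(** Versions of a density carry no sign condition; this lemma allows working with nonnegative
    ones. *)
Lemma RN_version_maxr0 (f : X -> R) : (forall B, 0 <= nu B) ->
  RN_version nu phi f -> RN_version nu phi (fun x => Num.max (f x) 0%R).
Proof.
move=> nu0 [mf nuE]; split; first exact: measurable_maxr.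
move=> B mB; rewrite nuE// integralE.
have pos D : \int[phi]_(x in D) (EFin \o f)^\+ x =
             \int[phi]_(x in D) (Num.max (f x) 0%R)%:E.
  by apply: eq_integral => x _; rewrite funeposE EFin_max.
pose N := [set x | (f x < 0)%R].
have mN : measurable N.
  exact: (measurable_set_ltr mf (measurable_cst (0%R : R))).
have mneg D : measurable_fun D (EFin \o f)^\-.
  apply: measurable_funTS; apply: measurable_funeneg.
  exact/measurable_EFinP.
have mBN : measurable (B `&` N) by exact: measurableI.
have mBNC : measurable (B `&` ~` N).
  by apply: measurableI => //; exact: measurableC.
have -> : \int[phi]_(x in B) (EFin \o f)^\- x = 0; last by rewrite sube0 pos.
have BE : B = (B `&` N) `|` (B `&` ~` N) by rewrite -setIUr setUv setIT.
rewrite BE ge0_integral_setU//; last first.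
  by apply/disj_setPS; rewrite setIACA setICr setI0.
rewrite [X in _ + X]integral0_eq ?adde0; last first.
  by move=> x [_ /negP]; rewrite -leNgt => f0; rewrite funenegE/=;
     apply/max_idPr; rewrite lee_fin oppr_le0.
(* On [N] the positive part vanishes, so nonnegativity of [nu] forces the integral of the negative
   part to be at most 0. *)
have := nu0 (B `&` N); rewrite nuE// integralE.
rewrite [X in X - _]integral0_eq ?sub0e ?oppe_ge0; last first.
  by move=> x [_ /ltW f0]; rewrite funeposE/=; apply/max_idPr; rewrite lee_fin.
by move=> le0; apply/eqP; rewrite eq_le le0/=; exact: integral_ge0.
Qed.

Lemma density_le (f : X -> R) (B : set X) (c : R) : RN_version nu phi f ->
  measurable B -> (0 <= c)%R -> (forall x, B x -> (0 <= f x)%R) ->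
  (forall x, B x -> (1 <= c * f x)%R) -> phi B <= c%:E * nu B.
Proof.
move=> [mf nuE] mB c0 f0 cf.
have mE := measurable_funTS_EFin (B := B) mf.
rewrite nuE// -ge0_integralZl//.
rewrite -[leLHS]mul1e -integral_cst//; apply: ge0_le_integral => //.
exact: measurable_funeM.
Qed.

End densities.

Section mutual_singularity.
Context (R : realType) (X : pointedType).
Variables (S T : X -> X) (A : set (set X)).
Hypotheses (SK : cancel S T) (TK : cancel T S).
Let X0 := space0 S A.
Let XZ := spaceZ S A.
Variables (phi : {measure set X0 -> \bar R}) (m1 m2 : probability XZ R).
Variables (f1 f2 : X -> R).
Hypotheses (f1_ge0 : forall x, (0 <= f1 x)%R) (f2_ge0 : forall x, (0 <= f2 x)%R).
Hypotheses (f1E : RN_version (T := X0) m1 phi f1)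
  (f2E : RN_version (T := X0) m2 phi f2).
Hypotheses (erg1 : ergodic (S : XZ -> XZ) m1) (erg2 : ergodic (S : XZ -> XZ) m2).

(* The positive set of [m1 - m2] on the smallest sigma-algebra is invariant up
   to a null set because the signed measure is invariant. *)
Lemma ergodic_distinct_singular :
  (exists2 B : set XZ, measurable B & m1 B <> m2 B) ->
  let P : set X0 := [set x | (f2 x < f1 x)%R] in
  [/\ measurable P, m1 (~` P) = 0 & m2 P = 0].
Proof.
move=> m12 P; have [mf1 m1E] := f1E; have [mf2 m2E] := f2E.
have [inv1 _] := erg1; have [inv2 _] := erg2.
have mE := @measurable_funTS_EFin _ X0 R.
have mP : measurable P.
  exact: measurable_set_ltr.
have mZ (B : set X0) : measurable B -> measurable (B : set XZ).
  exact: measurable_space0_spaceZ.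
have leP (B : set X0) : measurable B -> B `<=` P -> m2 B <= m1 B.
  move=> mB BP; rewrite m1E// m2E//; apply: ge0_le_integral => //.
  - by move=> x _; rewrite lee_fin.
  - exact: mE.
  - exact: mE.
  - by move=> x /BP/ltW; rewrite lee_fin.
have lePC (B : set X0) : measurable B -> B `<=` ~` P -> m1 B <= m2 B.
  move=> mB BP; rewrite m1E// m2E//; apply: ge0_le_integral => //.
  - by move=> x _; rewrite lee_fin.
  - exact: mE.
  - exact: mE.
  - by move=> x /BP/negP; rewrite -leNgt lee_fin.
have mSP : measurable (S @^-1` P : set X0).
  exact: (measurable_preimage_iter (@measurable_shift0 _ S A) 1%N mP).
have mI : measurable (P `&` S @^-1` P : set X0) by exact: measurableI.
have ma : measurable (P `\` S @^-1` P : set X0) by exact: measurableD.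
have mb : measurable (S @^-1` P `\` P : set X0) by exact: measurableD.
have ab (m : probability XZ R) : invariant_measure (S : XZ -> XZ) m ->
    m (P `\` S @^-1` P) = m (S @^-1` P `\` P).
  move=> inv; have e : m (S @^-1` P) = m P by apply: inv; exact: mZ.
  have e1 : m (S @^-1` P) = m (S @^-1` P `\` P) + m (S @^-1` P `&` P).
    by apply: measureDI; exact: mZ.
  have e2 : m P = m (P `\` S @^-1` P) + m (S @^-1` P `&` P).
    by rewrite setIC; apply: measureDI; exact: mZ.
  have If : m (S @^-1` P `&` P) \is a fin_num.
    by rewrite setIC; apply: fin_num_measure; exact: mZ.
  by apply/eqP; rewrite eq_le; apply/andP; split;
    rewrite -(leeD2rE _ _ If) -e1 -e2 e.
(* By [ab], both masses of this set equal those of a set outside [P], where [m1] is at most [m2];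
   yet its own density is strictly larger for [m1]. *)
have phi_a : phi (P `\` S @^-1` P) = 0.
  apply: (@strict_density_null _ X0 R phi f2 f1) => //.
  - by move=> x [Px _]; rewrite f2_ge0.
  - by rewrite -m2E//; apply: fin_num_measure; exact: mZ.
  - rewrite -m1E// -m2E// ab// (ab m2)//; exact: lePC.
have a1 : m1 (P `\` S @^-1` P) = 0.
  by rewrite m1E//; apply: null_set_integral => //; exact: mE.
have a2 : m2 (P `\` S @^-1` P) = 0.
  by rewrite m2E//; apply: null_set_integral => //; exact: mE.
have mSZ := @measurable_shiftZ _ S T A SK TK.
(* Domination on the base extends to the large sigma-algebra; for two probabilities, passing to
   complements turns it into equality. *)
have distinct (m m' : probability XZ R) :
    (exists2 B : set XZ, measurable B & m B <> m' B) ->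
    invariant_measure (S : XZ -> XZ) m -> invariant_measure (S : XZ -> XZ) m' ->
    ~ (forall B : set X0, measurable B -> m B <= m' B).
  move=> [B mB neq] inv inv' le0.
  have leZ := invariant_extension_le SK TK inv inv' le0.
  apply: neq; apply/eqP; rewrite eq_le; apply/andP; split; first exact: leZ.
  have : m (~` B) <= m' (~` B) by apply: leZ; exact: measurableC.
  rewrite (probability_setC m mB) (probability_setC m' mB).
  have Bf : m B \is a fin_num by exact: fin_num_measure.
  have Bf' : m' B \is a fin_num by exact: fin_num_measure.
  by rewrite -(fineK Bf) -(fineK Bf') -!EFinB !lee_fin lerD2l lerN2.
have split (m : probability XZ R) (B : set X0) : measurable B ->
    m B = m (B `\` P) + m (B `&` P).
  by move=> mB; apply: measureDI; exact: mZ.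
(* If [P] were [m1]-null, [m1] would be dominated by [m2] on the base. Symmetrically, [m2] cannot
   live on [P]. *)
have [P1|PC1] := ergodic_quasi_invariant mSZ erg1 (mZ _ mP) a1.
  exfalso; apply: (distinct m1 m2) => // B mB.
  rewrite (split m1)// (split m2)//.
  have -> : m1 (B `&` P) = 0.
    by apply: (@subset_measure0 _ XZ R m1 _ P) => //;
      [apply: mZ; exact: measurableI|exact: mZ].
  rewrite adde0; apply: (@le_trans _ _ (m2 (B `\` P))); last exact: leeDl.
  by apply: lePC; [exact: measurableD|move=> x []].
have [P2|PC2] := ergodic_quasi_invariant mSZ erg2 (mZ _ mP) a2; first by [].
exfalso; apply: (distinct m2 m1) => //.
  by have [B mB neq] := m12; exists B => // e; exact: neq.
move=> B mB; rewrite (split m1)// (split m2)//.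
have -> : m2 (B `\` P) = 0.
  apply: (@subset_measure0 _ XZ R m2 _ (~` P)) => //.
    by apply: mZ; exact: measurableD.
  by apply: mZ; exact: measurableC.
rewrite add0e; apply: (@le_trans _ _ (m1 (B `&` P))); last exact: leeDr.
by apply: leP; [exact: measurableI|move=> x []].
Qed.

End mutual_singularity.

(** * Bounds from the ergodic components *)

Lemma esum_single (R : realType) (I : choiceType) (a : I -> \bar R) (i : I) :
  (forall j, 0 <= a j) -> (forall j, j != i -> a j = 0) ->
  \esum_(j in [set: I]) a j = a i.
Proof.
move=> a0 ai; rewrite (esumID [set i])// setTI esum_set1//.
by rewrite esum1 ?adde0// => j [_ /eqP]; exact: ai.
Qed.

Lemma outer_measure_bigcup_esum (R : realType) (X : Type) (I : countType)
    (mu : {outer_measure set X -> \bar R}) (F : I -> set X) :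
  mu (\bigcup_i F i) <= \esum_(i in [set: I]) mu (F i).
Proof.
(* The index type is enumerated by its codes; numbers that code nothing contribute the empty set. *)
pose G n := if pickle_inv n is Some i then F i else set0.
have -> : \bigcup_i F i = \bigcup_n G n.
  apply/seteqP; split => [x [i _ Fx]|x [n _]].
    by exists (pickle i) => //; rewrite /G pickleK_inv.
  by rewrite /G; case: pickle_inv => // i Fx; exists i.
apply: le_trans (outer_measure_sigma_subadditive _ _) _.
rewrite nneseries_esumT; last by move=> n; exact: outer_measure_ge0.
rewrite (_ : \esum_(n in setT) _ = \esum_(n in range (@pickle I)) mu (G n)).
  rewrite (reindex_esum setT _ (@pickle I)); last first.
    split=> [i _|i j _ _|//]; first by exists i.
    exact: (pcan_inj (@pickleK_inv I)).
  by apply: le_esum => i _; rewrite /G pickleK_inv.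
rewrite [RHS]esum_mkcond; apply: eq_esum => n _.
case: ifPn => // /negP nr; rewrite /G; case e : (pickle_inv n) => [i|].
  exfalso; apply: nr; rewrite inE; exists i => //.
  by have := @pickle_invK I n; rewrite /ocancel e.
exact: outer_measure0.
Qed.

Lemma esumZl_le (R : realType) (I : choiceType) (D : set I) (a : I -> \bar R)
    (c : R) : (0 <= c)%R -> (forall i, 0 <= a i) ->
  \esum_(i in D) (c%:E * a i) <= c%:E * \esum_(i in D) a i.
Proof.
move=> c0 a0; apply: ge_ereal_sup => _ [F [finF FD] <-].
rewrite -ge0_mule_fsumr//; apply: lee_wpmul2l => //.
by apply: esum_ge; exists F.
Qed.

Section decomposition.
Context (R : realType) (X : pointedType).
Variables (S T : X -> X) (A : set (set X)).
Hypotheses (SK : cancel S T) (TK : cancel T S).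
Let X0 := space0 S A.
Let XZ := spaceZ S A.
Variables (phi Lam : {finite_measure set X0 -> \bar R}) (Z : X -> R).
Hypotheses (Z_ge0 : forall x, (0 <= Z x)%R)
  (Z_RN : RN_version (T := X0) Lam phi Z).
Variable LamZ : {finite_measure set XZ -> \bar R}.
Hypotheses (LamZ_inv : invariant_measure (S : XZ -> XZ) LamZ)
  (LamZ_ext : forall B : set X0, measurable B -> LamZ B = Lam B).
Variables (I : countType) (lam : I -> R) (L : I -> probability XZ R).
Hypotheses (lam_gt0 : forall i, (0 < lam i)%R)
  (L_erg : forall i, ergodic (S : XZ -> XZ) (L i))
  (LamZ_sum : forall B : set XZ, measurable B ->
     LamZ B = \esum_(i in [set: I]) ((lam i)%:E * L i B)).
Variable f : I -> X -> R.
Hypotheses (f_ge0 : forall i x, (0 <= f i x)%R)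
  (f_RN : forall i, RN_version (T := X0) (L i) phi (f i)).
Variable F : I -> set X0.
Hypotheses (mF : forall i, measurable (F i)) (tF : trivIset setT F)
  (F1 : forall i, L i (~` F i) = 0)
  (F0 : forall i j, j != i -> L j (F i) = 0).
(** [b i] stands for the inverse of [M_i], with value 0 when [M_i] is infinite. Its two
    characteristic properties, [b_upper] and [b_lower], are assumed only in the section for the
    respective bound. *)
Variable b : I -> R.
Hypothesis b_ge0 : forall i, (0 <= b i)%R.

Let mZ (B : set X0) : measurable B -> measurable (B : set XZ).
Proof. exact: measurable_space0_spaceZ. Qed.

Let mfun_f i : measurable_fun [set: X0] (f i : X0 -> R).
Proof. by have [] := f_RN i. Qed.

Let mfun_Z : measurable_fun [set: X0] (Z : X0 -> R).
Proof. by have [] := Z_RN. Qed.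

Let mset_gt (g : X0 -> R) (c : R) : measurable_fun [set: X0] g ->
  measurable ([set x | (c < g x)%R] : set X0).
Proof. by move=> mg; exact: (measurable_set_ltr (measurable_cst c) mg). Qed.

Let L_null i (B C : set XZ) : measurable B -> measurable C -> B `<=` C ->
  L i C = 0 -> L i B = 0.
Proof. by move=> mB mC BC; apply: (@subset_measure0 _ XZ R (L i)). Qed.

Lemma component_mass i (B : set X0) : measurable B -> B `<=` F i ->
  Lam B = (lam i)%:E * L i B.
Proof.
move=> mB BF; rewrite -LamZ_ext// LamZ_sum; last exact: mZ.
apply: esum_single => j; first by rewrite mule_ge0// lee_fin ltW.
by move=> /F0 Fj0; rewrite (L_null _ _ BF)// ?mule0//; exact: mZ.
Qed.

Lemma component_mass_le i (B : set X0) : measurable B ->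
  (lam i)%:E * L i B <= Lam B.
Proof.
move=> mB; rewrite -LamZ_ext// LamZ_sum; last exact: mZ.
apply: esum_ge; exists [set i]; first by split.
by rewrite fsbig_set1.
Qed.

Section upper_bound.
(** This generality serves two cases: a measure dominating the integral of [Z^c] for [0 < c < 1],
    and [phi] itself with [c = 0] under absolute continuity. *)
Variables (w : {finite_measure set X0 -> \bar R}) (c : R).
Hypotheses (c_ge0 : (0 <= c)%R)
  (w_le : forall B : set X0, measurable B ->
     w B <= c%:E * Lam B + phi (B `&` [set x | (0 < Z x)%R])).
Hypothesis b_upper : forall i s, (b i < s)%R ->
  L i [set x | (1 < s * f i x)%R] != 0.

Let h := tail_outer (T : X0 -> X0) w.

Let hU (P Q : set X) : h (P `|` Q) <= h P + h Q.
Proof. exact: outer_measureU2. Qed.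

Let h_ge0 Q : 0 <= h Q. Proof. exact: outer_measure_ge0. Qed.

Let le_h P Q : P `<=` Q -> h P <= h Q. Proof. exact: le_tail_outer. Qed.

(** Where [Z] exceeds [1/(k+1)], [w] is at most [c + k + 1] times [Lam], so sweeping from there
    costs nothing on [Q]. These sets exhaust [Z > 0], and [Z = 0] is [w]-null. *)
Lemma tail_outer_null (Q : set XZ) : measurable Q -> LamZ Q = 0 -> h Q = 0.
Proof.
move=> mQ Q0; pose D (k : nat) : set X0 := [set x | (1 < k.+1%:R * Z x)%R].
have mD k : measurable (D k) by apply: mset_gt; exact: measurable_funM.
pose E (k : nat) : set X := \bigcup_j (iter j T @^-1` D k).
have hE k : h (Q `&` E k) = 0.
  have ck : (0 < c + k.+1%:R)%R by rewrite ltr_wpDl.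
  have wD (B : set X0) : measurable B -> B `<=` D k ->
      w B <= (c + k.+1%:R)%:E * LamZ B.
    move=> mB BD; rewrite LamZ_ext//; apply: le_trans (w_le mB) _.
    rewrite EFinD ge0_muleDl ?lee_fin//.
    apply: leeD2l; apply: (@le_trans _ _ (phi B)).
      apply: le_measure; rewrite ?inE//; apply: measurableI => //.
      exact: mset_gt.
    apply: (density_le Z_RN) => // x /BD; rewrite /D/=; exact: ltW.
  apply/eqP; rewrite eq_le h_ge0 andbT.
  have := tail_outer_sweep SK TK LamZ_inv (mD k) ck wD mQ.
  by rewrite Q0 mule0.
pose N : set X0 := [set x | Z x = 0%R].
have mN : measurable N.
  rewrite (_ : N = ~` [set x | (0 < Z x)%R]).
    by apply: measurableC; exact: mset_gt.
  apply/seteqP; split => x /=; first by move=> ->; rewrite ltxx.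
  by move=> /negP; rewrite -leNgt => Zx; apply/eqP; rewrite eq_le Zx Z_ge0.
have hN : h N = 0.
  apply/eqP; rewrite eq_le h_ge0 andbT.
  apply: le_trans (tail_outer_le _ _ _ mN) _ => //; apply: le_trans (w_le mN) _.
  rewrite (_ : N `&` _ = set0) ?measure0 ?adde0; last first.
    by apply/seteqP; split => // x [/= ->]; rewrite ltxx.
  have [_ ->//] := Z_RN; rewrite integral0_eq ?mule0//.
  by move=> x /= ->.
apply/eqP; rewrite eq_le h_ge0 andbT.
apply: (@le_trans _ _ (h (\bigcup_k (Q `&` E k)) + h N)); last first.
  rewrite hN adde0; apply: le_trans (outer_measure_sigma_subadditive _ _) _.
  by rewrite eseries0// => k _ _; exact: hE.
apply: le_trans (hU _ _); apply: le_h => x Qx.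
have [Zx0|Zx0] := eqVneq (Z x) 0%R; [by right|left].
have Zx : (0 < Z x)%R by rewrite lt_neqAle eq_sym Zx0 Z_ge0.
(* With [k] the integer part of [1 / Z x], the number [k + 1] is larger than [1 / Z x]. *)
exists (Num.truncn (Z x)^-1) => //; split => //; exists 0%N => //.
by rewrite /D/= -ltr_pdivrMr// div1r truncnS_gt.
Qed.

(** For [s > b i], sweep from the part of [F i] where [s * f i > 1]. It has positive mass, so by
    ergodicity its orbit misses only an [L i]-null set; then [s] decreases to [b i]. *)
Lemma tail_outer_component i (Q : set XZ) : measurable Q ->
  h (Q `&` F i) <= (c * lam i + b i)%:E * L i Q.
Proof.
move=> mQ; have [LinvE _] := L_erg i.
have hs s : (b i < s)%R -> h (Q `&` F i) <= (c * lam i + s)%:E * L i Q.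
  move=> bs; have s0 : (0 < s)%R by exact: le_lt_trans bs.
  pose P : set X0 := [set x | (1 < s * f i x)%R].
  have mP : measurable P by apply: mset_gt; exact: measurable_funM.
  pose D : set X0 := F i `&` P.
  have mD : measurable D by exact: measurableI.
  have LD : L i D != 0.
    apply/eqP => LD0; have /eqP := b_upper bs; apply.
    have mDF : measurable (D `|` ~` F i : set XZ).
      by apply: mZ; apply: measurableU => //; exact: measurableC.
    apply: (L_null (mZ mP) mDF); last first.
      have mFC : measurable (~` F i : set XZ) by apply: mZ; exact: measurableC.
      exact: (null_set_setU (mu := L i) (mZ mD) mFC LD0 (F1 i)).
    by move=> x Px; have [Fx|Fx] := pselect (F i x); [left|right].
  pose E : set X := \bigcup_j (iter j T @^-1` D).
  have mE : measurable (E : set XZ).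
    apply: bigcup_measurable => k _; apply: (measurableZ_iter_inv SK TK).
    exact: mZ.
  have LE : L i (~` E) = 0.
    apply: (ergodic_sweep (measurable_shiftZ SK TK) (L_erg i) SK) => //.
    - exact: (measurable_shiftZ_inv SK TK).
    - exact: mZ.
  have mQF : measurable (Q `&` F i : set XZ) by apply: measurableI => //; exact: mZ.
  have mQFE : measurable (Q `&` F i `&` ~` E : set XZ).
    by apply: measurableI => //; exact: measurableC.
  (* The unswept part is null for [L i] by ergodicity and for every other component because it lies
     in [F i]. *)
  have h0 : h (Q `&` F i `&` ~` E) = 0.
    apply: tail_outer_null => //; rewrite LamZ_sum//; apply: esum1 => j _.
    have [->|ji] := eqVneq j i.
      by rewrite (L_null mQFE (measurableC mE) _ LE) ?mule0// => x [].
    by rewrite (L_null mQFE (mZ (mF i)) _ (F0 ji)) ?mule0// => x [[]].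
  apply: (@le_trans _ _ (h (Q `&` F i `&` E) + h (Q `&` F i `&` ~` E))).
    by apply: le_trans (hU _ _); rewrite -setIUr setUv setIT.
  rewrite h0 adde0.
  apply: (@le_trans _ _ (h (Q `&` E))); first by apply: le_h => x [[]].
  apply: tail_outer_sweep => //; first by rewrite ltr_wpDl// mulr_ge0// ltW.
  move=> B mB BD; have BF : B `<=` F i by move=> x /BD[].
  apply: le_trans (w_le mB) _; rewrite (component_mass mB BF).
  have clam_ge0 : (0 <= c * lam i)%R by rewrite mulr_ge0// ltW.
  rewrite EFinD ge0_muleDl ?lee_fin ?(ltW s0)// EFinM muleA leeD2l//.
  apply: (@le_trans _ _ (phi B)).
    by apply: le_measure; rewrite ?inE//; apply: measurableI => //; exact: mset_gt.
  by apply: (density_le (f_RN i)) => //; [exact: ltW|move=> x /BD[_ /ltW]].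
apply/lee_addgt0Pr => e e0.
rewrite (le_trans (hs (b i + e)%R _))// ?ltrDl//.
have clam_ge0 : (0 <= c * lam i)%R by rewrite mulr_ge0// ltW.
rewrite addrA EFinD ge0_muleDl ?lee_fin ?addr_ge0 ?(ltW e0)//.
rewrite leeD2l// -[leRHS]mule1 lee_pmul2l//.
exact: probability_le1.
Qed.

Lemma tail_outer_upper (Q : set XZ) : measurable Q ->
  h Q <= c%:E * LamZ Q + \esum_(i in [set: I]) ((b i)%:E * L i Q).
Proof.
move=> mQ; pose N : set XZ := Q `&` ~` \bigcup_i F i.
have mUF : measurable (\bigcup_i F i : set XZ).
  by apply: countable_bigcupT_measurable => // i; exact: mZ.
have hN : h N = 0.
  have mN : measurable N by apply: measurableI => //; exact: measurableC.
  apply: tail_outer_null => //; rewrite LamZ_sum//; apply: esum1 => i _.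
  have mFC : measurable (~` F i : set XZ) by apply: mZ; exact: measurableC.
  rewrite (L_null mN mFC _ (F1 i)) ?mule0// => x [_ Fx] Fix.
  by apply: Fx; exists i.
apply: (@le_trans _ _ (h (\bigcup_i (Q `&` F i)) + h N)).
  apply: le_trans (hU _ _); apply: le_h => x Qx.
  have [[i _ Fx]|nF] := pselect ((\bigcup_i F i) x); [left|right] => //.
  by exists i.
rewrite hN adde0; apply: le_trans (outer_measure_bigcup_esum _ _) _.
apply: (@le_trans _ _ (\esum_(i in [set: I])
    (c%:E * ((lam i)%:E * L i Q) + (b i)%:E * L i Q))).
  apply: le_esum => i _; apply: le_trans (tail_outer_component i mQ) _.
  have clam_ge0 : (0 <= c * lam i)%R by rewrite mulr_ge0// ltW.
  by rewrite EFinD ge0_muleDl ?lee_fin// EFinM muleA.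
have lamL_ge0 i : 0 <= (lam i)%:E * L i Q by rewrite mule_ge0// lee_fin ltW.
rewrite esumD; last 2 first.
- by move=> i _; rewrite mule_ge0.
- by move=> i _; rewrite mule_ge0 ?lee_fin.
by rewrite leeD2r// LamZ_sum//; exact: esumZl_le.
Qed.

End upper_bound.

Section lower_bound.
Hypothesis b_lower : forall i, L i [set x | (1 < b i * f i x)%R] = 0.

(** [G] is [F i] without the points violating either inequality. The first exceptional set is
    [phi]-null because [lam i] times [L i] is at most [Lam]; the second is [L i]-null by
    [b_lower]. *)
Lemma component_density_le i : exists G : set X0,
  [/\ measurable G, G `<=` F i, L i (~` G) = 0 &
      forall x, G x -> (lam i * f i x <= Z x)%R /\ (b i * f i x <= 1)%R].
Proof.
pose N1 : set X0 := [set x | (Z x < lam i * f i x)%R].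
pose N2 : set X0 := [set x | (1 < b i * f i x)%R].
have mlf : measurable_fun [set: X0] (fun x => lam i * f i x)%R.
  exact: measurable_funM.
have mN1 : measurable N1 by exact: measurable_set_ltr.
have mN2 : measurable N2 by apply: mset_gt; exact: measurable_funM.
have [_ ZE] := Z_RN; have [_ fE] := f_RN i.
have phi0 : phi N1 = 0.
  apply: (@strict_density_null _ X0 R phi Z (fun x => lam i * f i x)%R) => //.
  - by move=> x N1x; rewrite Z_ge0.
  - by rewrite -ZE//; exact: fin_num_measure.
  - rewrite -ZE// (le_trans _ (component_mass_le i mN1))//.
    under eq_integral do rewrite EFinM.
    rewrite ge0_integralZl//; last 3 first.
    + exact: measurable_funTS_EFin.
    + by move=> x _; rewrite lee_fin.
    + by rewrite lee_fin ltW.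
    by rewrite -fE.
have L1 : L i N1 = 0.
  by rewrite fE//; apply: null_set_integral => //; exact: measurable_funTS_EFin.
exists (F i `&` ~` N1 `&` ~` N2); split.
- by apply: measurableI; [apply: measurableI => //|]; exact: measurableC.
- by move=> x [[]].
- rewrite !setCI !setCK.
  have mFC : measurable (~` F i : set XZ) by apply: mZ; exact: measurableC.
  have U1 := null_set_setU (mu := L i) mFC (mZ mN1) (F1 i) L1.
  have mU1 : measurable (~` F i `|` N1 : set XZ).
    by apply: mZ; apply: measurableU => //; exact: measurableC.
  exact: (null_set_setU (mu := L i) mU1 (mZ mN2) U1 (b_lower i)).
- by move=> x [[_ /negP]]; rewrite -leNgt => ? /negP; rewrite -leNgt.
Qed.

(** Write [f] as [f^a * f^(1-a)]: the first factor with [lam^a] is at most [Z^a], the second with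
    [b^(1-a)] is at most 1. *)
Lemma component_powR_le i (a : R) x : (0 <= a <= 1)%R ->
  (lam i * f i x <= Z x)%R -> (b i * f i x <= 1)%R ->
  (lam i `^ a * b i `^ (1 - a) * f i x <= Z x `^ a)%R.
Proof.
move=> /andP[a0 a1] lf bf; have [fx0|fx0] := eqVneq (f i x) 0%R.
  by rewrite fx0 mulr0 powR_ge0.
have fxE : f i x = (f i x `^ a * f i x `^ (1 - a))%R.
  by rewrite -powRD ?fx0 ?implybT// addrCA subrr addr0 powRr1.
have lam0 : (0 <= lam i)%R by exact: ltW.
rewrite [X in (_ * X)%R]fxE mulrACA -!powRM//.
apply: (@le_trans _ _ (Z x `^ a * 1)%R); last by rewrite mulr1.
apply: ler_pM; rewrite ?powR_ge0//.
  by apply: ge0_ler_powR; rewrite ?nnegrE ?mulr_ge0.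
have powR1E : (1 `^ (1 - a) = 1 :> R)%R by rewrite powR1.
rewrite -[leRHS]powR1E.
by apply: ge0_ler_powR; rewrite ?nnegrE ?mulr_ge0 ?subr_ge0.
Qed.

(** The sets [G i] are disjoint, so the integral over [B] is at least the sum of those over its
    parts in the [G i]. A finite family suffices, since the full sum is a supremum of finite
    ones. *)
Lemma integral_powR_lower (s : seq I) (a : R) (B : set X0) :
  (0 <= a <= 1)%R -> uniq s -> measurable B ->
  \sum_(i <- s) ((lam i `^ a * b i `^ (1 - a))%:E * L i B) <=
  \int[phi]_(x in B) (Z x `^ a)%:E.
Proof.
move=> a01 us mB; have /choice[G GP] := component_density_le.
have mG i : measurable (G i) by have [] := GP i.
have mBG i : measurable (B `&` G i) by exact: measurableI.
have mfun_Za : measurable_fun [set: X0] (fun x => Z x `^ a)%R.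
  by apply: (measurableT_comp (measurable_powR a)).
have Za0 x : 0 <= (Z x `^ a)%:E by rewrite lee_fin powR_ge0.
have tG : trivIset [set` s] (fun i => B `&` G i).
  apply/trivIsetP => i j _ _ ij; rewrite -subset0 => x [[_ Gi] [_ Gj]].
  have [_ GFi _ _] := GP i; have [_ GFj _ _] := GP j.
  move/trivIsetP: tF => /(_ i j Logic.I Logic.I ij) <-.
  by split; [exact: GFi|exact: GFj].
apply: (@le_trans _ _ (\int[phi]_(x in \big[setU/set0]_(i <- s) (B `&` G i))
    (Z x `^ a)%:E)); last first.
  apply: ge0_subset_integral => //.
  - exact: bigsetU_measurable.
  - exact: measurable_funTS_EFin.
  - by move=> x; rewrite -bigcup_seq => -[i _ []].
rewrite ge0_integral_bigsetU//; last exact: measurable_funTS_EFin.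
apply: lee_sum => i _; have [_ _ Gi0 Gle] := GP i; have [_ fE] := f_RN i.
have -> : L i B = L i (B `&` G i).
  have -> : L i B = L i (B `\` G i) + L i (B `&` G i).
    by apply: measureDI; exact: mZ.
  have mGC : measurable (~` G i : set XZ) by apply: mZ; exact: measurableC.
  have mBD : measurable (B `\` G i : set XZ) by apply: mZ; exact: measurableD.
  by rewrite (L_null mBD mGC _ Gi0) ?add0e// => x [].
have k0 : (0 <= lam i `^ a * b i `^ (1 - a))%R by rewrite mulr_ge0 ?powR_ge0.
rewrite fE// -ge0_integralZl//; last 2 first.
- exact: (measurable_funTS_EFin (mfun_f i)).
- by move=> x _; rewrite lee_fin.
apply: ge0_le_integral => //.
- by move=> x _; rewrite mule_ge0 ?lee_fin.
- by apply: measurable_funeM; exact: measurable_funTS_EFin.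
- exact: measurable_funTS_EFin.
- by move=> x [_ /Gle[lf bf]]; rewrite -EFinM lee_fin component_powR_le.
Qed.

(** The integral bound is used on each member of a cover; after interchanging the sums, the cost of
    the cover for each invariant [L i] is at least [L i Q]. *)
Lemma tail_outer_powR_lower (s : seq I) (a : R) (Q : set XZ) :
  (0 <= a <= 1)%R -> uniq s -> measurable Q ->
  \sum_(i <- s) ((lam i `^ a * b i `^ (1 - a))%:E * L i Q) <=
  tail_outer (T : X0 -> X0) (fun B => \int[phi]_(x in B) (Z x `^ a)%:E) Q.
Proof.
move=> a01 us mQ; apply: le_ereal_inf_tmp => _ [B [mB QB] <-].
have k0 i : (0 <= lam i `^ a * b i `^ (1 - a))%R by rewrite mulr_ge0 ?powR_ge0.
have kL0 i (C : set XZ) : 0 <= (lam i `^ a * b i `^ (1 - a))%:E * L i C.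
  by rewrite mule_ge0 ?lee_fin.
apply: (@le_trans _ _ (\sum_(n <oo) \sum_(i <- s)
    ((lam i `^ a * b i `^ (1 - a))%:E * L i (B n)))); last first.
  apply: lee_nneseries => n _; last exact: integral_powR_lower.
  by move=> _; apply: sume_ge0 => i _; exact: kL0.
rewrite nneseries_sum//.
apply: lee_sum => i _; rewrite nneseriesZl//.
apply: lee_wpmul2l; first by rewrite lee_fin.
have [inv _] := L_erg i.
apply: le_trans (tail_outer_restriction_ge SK TK inv mQ) _.
by apply: ereal_inf_lbound; exists B.
Qed.

End lower_bound.
End decomposition.

(** * The limit at 0 *)

Lemma cvg_powR_exponent (R : realType) (Y : Type) (G : set_system Y)
    {FG : Filter G} (g : Y -> R) (x l : R) : (0 < x)%R ->
  g y @[y --> G] --> l -> (x `^ g y)%R @[y --> G] --> (x `^ l)%R.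
Proof.
move=> x0 gl; have powRE (p : R) : (x `^ p = expR (p * ln x))%R.
  by rewrite /powR gt_eqF.
rewrite powRE; under eq_fun do rewrite powRE.
apply: continuous_cvg; first exact: continuous_expR.
by apply: cvgM => //; exact: cvg_cst.
Qed.

Lemma cvg_powR_mean (R : realType) (x y : R) : (0 < x)%R -> (0 <= y)%R ->
  (x `^ a * y `^ (1 - a))%R @[a --> 0^'+] --> y.
Proof.
move=> x0; rewrite le_eqVlt => /predU1P[<-|y0].
  (* For [y = 0] the expression vanishes once [a < 1]; only the exponent [1 - a = 0] would give
     [0^0 = 1]. *)
  apply: cvg_near_cst; near=> a; rewrite powR0 ?mulr0//.
  by rewrite subr_eq0 gt_eqF//; near: a; exact: nbhs_right_lt.
have id0 : (a : R) @[a --> 0%R^'+] --> 0%R.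
  exact: cvg_within.
rewrite -[X in _ --> X](_ : x `^ 0 * y `^ (1 - 0) = y)%R; last first.
  by rewrite powRr0 mul1r subr0 powRr1// ltW.
apply: cvgM; apply: cvg_powR_exponent => //.
by apply: cvgB => //; exact: cvg_cst.
Unshelve. all: by end_near. Qed.

Lemma ereal_cvg_squeeze (R : realType) (Y : Type) (G : set_system Y)
    {FG : Filter G} (u : Y -> \bar R) (l : R) :
  (forall e : R, (0 < e)%R ->
     \forall y \near G, (l - e)%:E <= u y <= (l + e)%:E) ->
  u y @[y --> G] --> l%:E.
Proof.
move=> lu; apply/fine_cvgP; split.
  apply: filterS (lu 1%R ltr01) => y /andP[l1 l2].
  rewrite fin_numElt; apply/andP; split.
    by apply: lt_le_trans l1; exact: ltNyr.
  by apply: le_lt_trans l2 _; exact: ltry.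
apply/cvgrPdist_le => e e0; apply: filterS (lu e e0) => y /=.
case: (u y) => [r||]//=; last by rewrite leye_eq andbF.
by rewrite !lee_fin ler_distlC.
Qed.

(** Young's inequality for [y^a] and 1, with conjugate exponents [1/a] and [1/(1-a)]. *)
Lemma powR_le_affine (R : realType) (a y : R) : (0 < a < 1)%R -> (0 <= y)%R ->
  (y `^ a <= a * y + 1)%R.
Proof.
move=> /andP[a0 a1] y0; have a1' : (0 < 1 - a)%R by rewrite subr_gt0.
have := @conjugate_powR R (y `^ a)%R 1%R a^-1%R (1 - a)^-1%R (powR_ge0 _ _) ler01.
rewrite !invr_gt0 !invrK => /(_ a0 a1').
rewrite addrC subrK => /(_ erefl); rewrite mulr1 -powRrM divff ?gt_eqF//.
rewrite powRr1// powR1 mul1r => /le_trans; apply.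
by rewrite mulrC lerD2l gerBl ltW.
Qed.

(** * Covers of the statement and comparison of their costs *)

Section covers.
Context (R : realType) (X : pointedType).
Variables (S T : X -> X) (A : set (set X)).
Hypotheses (SK : cancel S T) (TK : cancel T S).
Let X0 := space0 S A.

Lemma covers_tail_outer (w : set X -> \bar R) (Q : set X) :
  ereal_inf [set \sum_(0 <= n <oo) w (spow S (- n%:Z)%R (C n)) |
             C in covers S A Q] = tail_outer (T : X0 -> X0) w Q.
Proof.
have sigmaAE n (C : set X) : sigmaA S A (- n%:Z)%R C <->
    exists2 B : set X0, measurable B & iter n T @^-1` B = C.
  rewrite /sigmaA opprK /=; split => -[B mB <-]; exists B => //.
    by rewrite -(image_iterE SK TK n B).
  by rewrite (image_iterE SK TK n B).
congr ereal_inf; apply/seteqP; split => [_ [C [mC QC] <-]|_ [B [mB QB] <-]].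
  exists (fun n => spow S (- n%:Z)%R (C n)) => //.
  have CE n : measurable (spow S (- n%:Z)%R (C n) : set X0) /\
      iter n T @^-1` (spow S (- n%:Z)%R (C n)) = C n.
    have /sigmaAE[B mB <-] := mC n.
    by rewrite spow_opp (preimage_iterK n B SK).
  split => [n|x /QC[n _ Cx]]; first by have [] := CE n.
  by exists n => //; have [_ ->] := CE n.
exists (fun n => iter n T @^-1` B n).
  by split => // n; apply/sigmaAE; exists (B n).
apply: eq_eseriesr => n _; congr w.
by rewrite spow_opp (preimage_iterK n (B n) SK).
Qed.

Lemma Phi_tail_outer (phi : {measure set X0 -> \bar R}) (Q : set X) :
  Phi phi Q = tail_outer (T : X0 -> X0) phi Q.
Proof. exact: covers_tail_outer. Qed.

Lemma Hausd_tail_outer (phi : {measure set X0 -> \bar R}) (Z : X -> R) (a : R)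
    (Q : set X) :
  Hausd phi Z a Q =
  tail_outer (T : X0 -> X0) (fun B => \int[phi]_(x in B) (Z x `^ a)%:E) Q.
Proof. exact: covers_tail_outer. Qed.

End covers.

Lemma le_tail_outer_fun d (X : measurableType d) (R : realType) (T : X -> X)
    (w w' : set X -> \bar R) (Q : set X) : (forall B, 0 <= w B) ->
  (forall B, measurable B -> w B <= w' B) ->
  tail_outer T w Q <= tail_outer T w' Q.
Proof.
move=> w0 ww'; apply: le_ereal_inf_tmp => _ [B [mB QB] <-].
apply: ge_ereal_inf; exists (\sum_(n <oo) w (B n)); first by exists B.
by apply: lee_nneseries => n _; [move=> _; exact: w0|exact: ww'].
Qed.

(** By the convention [0^0 = 1] the integrand is constantly 1, also where [Z] vanishes. *)
Lemma Hausd0 (R : realType) (X : pointedType) (S T : X -> X) (A : set (set X))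
    (phi : {measure set (space0 S A) -> \bar R}) (Z : X -> R) (Q : set X) :
  cancel S T -> cancel T S -> Hausd phi Z 0%R Q = Phi phi Q.
Proof.
move=> SK TK; rewrite (Hausd_tail_outer SK TK) (Phi_tail_outer SK TK).
have e (B : set (space0 S A)) : measurable B ->
    \int[phi]_(x in B) (Z x `^ 0)%:E = phi B.
  move=> mB; under eq_integral do rewrite powRr0.
  by rewrite integral_cst// mul1e.
apply/eqP; rewrite eq_le; apply/andP; split; apply: le_tail_outer_fun => //.
- by move=> B; apply: integral_ge0 => x _; rewrite lee_fin powR_ge0.
- by move=> B mB; rewrite e.
- by move=> B mB; rewrite e.
Qed.

Section comparison_measure.
Context d (X : measurableType d) (R : realType).
Variables (c : {nonneg R}) (Lam phi : {finite_measure set X -> \bar R}).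
Variables (P : set X) (mP : measurable P).

(** With [P] the set where [Z > 0] and [c = a], this dominates the integral of [Z^a] and comes with
    the finite measure structure that the upper bound requires. *)
Definition comparison_measure : set X -> \bar R :=
  measure_add (mscale c Lam) (mrestr phi mP).

HB.instance Definition _ := Measure.on comparison_measure.

Lemma comparison_measureE B :
  comparison_measure B = c%:num%:E * Lam B + phi (B `&` P).
Proof. by rewrite /comparison_measure measure_addE. Qed.

Let comparison_measure_fin : fin_num_fun comparison_measure.
Proof.
move=> B mB; rewrite comparison_measureE fin_numD fin_numM ?fin_num_measure//.
exact: measurableI.
Qed.

HB.instance Definition _ :=
  Measure_isFinite.Build _ _ _ comparison_measure comparison_measure_fin.

End comparison_measure.

(** Since [a > 0], the integrand vanishes where [Z = 0]; elsewhere it is at most [a * Z + 1]. *)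
Lemma integral_powR_le (R : realType) d (X : measurableType d)
    (phi : {measure set X -> \bar R}) (Lam : set X -> \bar R) (Z : X -> R)
    (a : R) (B : set X) :
  (0 < a < 1)%R -> (forall x, (0 <= Z x)%R) -> RN_version Lam phi Z ->
  measurable B ->
  \int[phi]_(x in B) (Z x `^ a)%:E <=
  a%:E * Lam B + phi (B `&` [set x | (0 < Z x)%R]).
Proof.
move=> a01 Z0 [mfZ LamE] mB; have /andP[a0 a1] := a01.
set P := [set x | (0 < Z x)%R].
have mP : measurable P by exact: (measurable_set_ltr (measurable_cst _) mfZ).
have mBP : measurable (B `&` P) by exact: measurableI.
have mBD : measurable (B `\` P) by exact: measurableD.
have mZa : measurable_fun [set: X] (fun x => Z x `^ a)%R.
  by apply: (measurableT_comp (measurable_powR a)).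
have mE g D := @measurable_funTS_EFin _ X R g D.
rewrite -[in leLHS](setDUK (@subIsetl _ B P)).
rewrite setDIr setDv set0U ge0_integral_setU//; last 3 first.
- exact: mE.
- by move=> x _; rewrite lee_fin powR_ge0.
- by apply/disj_setPS => x [[_ Px] []].
rewrite [X in _ + X]integral0_eq ?adde0; last first.
  move=> x [_ /negP]; rewrite -leNgt => Zx.
  have -> : Z x = 0%R by apply/eqP; rewrite eq_le Zx Z0.
  by rewrite powR0// gt_eqF.
apply: (@le_trans _ _ (\int[phi]_(x in B `&` P) ((a * Z x)%:E + 1))).
  apply: ge0_le_integral => //.
  - by move=> x _; rewrite lee_fin powR_ge0.
  - exact: mE.
  - by apply: emeasurable_funD => //; apply: mE; exact: measurable_funM.
  - by move=> x _; rewrite -EFinD lee_fin powR_le_affine.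
rewrite ge0_integralD//; last 2 first.
- by move=> x _; rewrite lee_fin mulr_ge0// ltW.
- by apply: mE; exact: measurable_funM.
rewrite integral_cst// mul1e leeD2r// LamE//.
under eq_integral do rewrite EFinM.
rewrite ge0_integralZl ?lee_fin ?(ltW a0)//; last 2 first.
- exact: mE.
- by move=> x _; rewrite lee_fin.
apply: lee_wpmul2l; first by rewrite lee_fin ltW.
apply: ge0_subset_integral => //; first exact: mE.
by move=> x _; rewrite lee_fin.
Qed.

(** * The inverse of the essential supremum *)

Section ess_sup_inverse.
Context (R : realType) (X : pointedType) (S : X -> X) (A : set (set X)).
Let X0 := space0 S A.
Let XZ := spaceZ S A.
Variables (phi : {measure set X0 -> \bar R}) (m : probability XZ R).
Variables (f : X -> R).
Hypothesis f_RN : RN_version (T := X0) m phi f.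

Lemma inverse_ess_sup : exists b : R,
  [/\ (0 <= b)%R, (ess_sup m (EFin \o f))^-1 = b%:E,
      forall s, (b < s)%R -> m [set x | (1 < s * f x)%R] != 0 &
      m [set x | (1 < b * f x)%R] = 0].
Proof.
set M := ess_sup m _; have [mf mE] := f_RN.
have mgt (r : R) : measurable ([set x | (r < f x)%R] : set XZ).
  apply: measurable_space0_spaceZ.
  exact: (measurable_set_ltr (measurable_cst _) mf).
have le_gt (y : R) : M <= y%:E -> m [set x | (y < f x)%R] = 0.
  move=> /ess_supP My; apply/(negligibleP m (mgt y)).
  apply: negligibleS My => x /=; rewrite lee_fin => yf.
  by apply/negP; rewrite -ltNge.
have gt_le (y : R) : m [set x | (y < f x)%R] = 0 -> M <= y%:E.
  move=> y0; apply/ess_supP.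
  have /(negligibleP m (mgt y)) := y0; apply: negligibleS => x /= /negP.
  by rewrite lee_fin -ltNge.
(* Otherwise the set where [f > 0] is null, and so is its complement, where the positive part of the
   density vanishes; but [m] is a probability. *)
have M0 : 0 < M.
  rewrite ltNge; apply/negP => M0.
  have m0 : m [set x | (0 < f x)%R] = 0 by exact: le_gt.
  have [_ mE'] : RN_version (T := X0) m phi (fun x => Num.max (f x) 0%R).
    by apply: RN_version_maxr0 => // B; exact: measure_ge0.
  have mP := measurable_set_ltr (measurable_cst (0%R : R)) mf.
  have mC0 : m (~` [set x | (0 < f x)%R]) = 0.
    rewrite mE'; last exact: measurableC.
    apply: integral0_eq => x /negP; rewrite -leNgt => fx.
    by rewrite (max_idPr fx).
  have := probability_setC m (mgt 0%R); rewrite mC0 m0 sube0 => /eqP.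
  by rewrite eq_sym onee_eq0.
move: M0 le_gt gt_le; case: M => [r||//] M0 le_gt gt_le.
  have r0 : (0 < r)%R by rewrite -lte_fin.
  exists r^-1%R; split.
  - by rewrite invr_ge0 ltW.
  - by rewrite inver gt_eqF.
  - move=> s rs; apply/eqP; have s0 : (0 < s)%R.
      by apply: le_lt_trans rs; rewrite invr_ge0 ltW.
    have -> : [set x | (1 < s * f x)%R] = [set x | (s^-1 < f x)%R].
      by apply/seteqP; split => x /=; rewrite -(ltr_pdivrMl _ _ s0) mulr1.
    move=> /gt_le; rewrite lee_fin leNgt => /negP; apply.
    by rewrite -[ltRHS]invrK ltf_pV2// posrE invr_gt0.
  - have -> : [set x | (1 < r^-1 * f x)%R] = [set x | (r < f x)%R].
      by apply/seteqP; split => x /=; rewrite ltr_pdivlMl// mulr1.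
    exact: le_gt.
(* An infinite essential supremum has inverse 0, and then no set [f > 1/s] with [s > 0] is null. *)
exists 0%R; split => //.
- move=> s s0; apply/eqP.
  have -> : [set x | (1 < s * f x)%R] = [set x | (s^-1 < f x)%R].
    by apply/seteqP; split => x /=; rewrite -(ltr_pdivrMl _ _ s0) mulr1.
  by move=> /gt_le; rewrite leye_eq.
- rewrite (_ : [set _ | _] = set0) ?measure0//.
  by apply/seteqP; split => // x /=; rewrite mul0r ltr10.
Qed.

End ess_sup_inverse.

Theorem corollary9 (R : realType) (X : pointedType) (S : X -> X)
    (A : set (set X))
    (bijS : bijective S)
    (sigma_A : sigma_algebra [set: X] A)
    (phi0 : {finite_measure set (space0 S A) -> \bar R})
    (Lambda : {finite_measure set (space0 S A) -> \bar R})
    (Lambda_inv : invariant_measure (S : space0 S A -> space0 S A) Lambda)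
    (Lambda_phi0 : Lambda `<< phi0)
    (Z : X -> R)
    (Z_ge0 : forall x, (0 <= Z x)%R)
    (Z_RN : RN_version (T := space0 S A) Lambda phi0 Z)
    (* the S-invariant extension of Lambda to the larger sigma-algebra *)
    (LambdaZ : {measure set (spaceZ S A) -> \bar R})
    (LambdaZ_inv : invariant_measure (S : spaceZ S A -> spaceZ S A) LambdaZ)
    (LambdaZ_ext : forall B : set X, <<s gen0 S A >> B -> LambdaZ B = Lambda B)
    (Lambda1 : Lambda [set: X] = 1)
    (I : countType)
    (lam : I -> R)
    (lam01 : forall i, (0 < lam i <= 1)%R)
    (L : I -> probability (spaceZ S A) R)
    (L_distinct : forall i j, i != j ->
       exists2 B : set (spaceZ S A), measurable B & L i B <> L j B)
    (L_ergodic : forall i, ergodic (S : spaceZ S A -> spaceZ S A) (L i))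
    (LambdaZ_sum : forall B : set (spaceZ S A), measurable B ->
       LambdaZ B = \esum_(i in [set: I]) ((lam i)%:E * L i B))
    (Zi : I -> X -> R)
    (Zi_RN : forall i, RN_version (T := space0 S A) (L i) phi0 (Zi i))
    (M : I -> \bar R)
    (M_def : forall i, M i = ess_sup (L i) (fun x => (Zi i x)%:E))
    (Q : set (spaceZ S A)) (measQ : measurable Q) :
  let continuous_at_0 :=
    Hausd phi0 Z alpha Q @[alpha --> within `[0%R, 1%R] (nbhs (0%R : R))]
      --> Hausd phi0 Z 0%R Q in
  (continuous_at_0 <->
     Phi phi0 Q = \esum_(i in [set: I]) ((M i)^-1 * L i Q)) /\
  (phi0 `<< Lambda -> continuous_at_0).
Proof.
move=> continuous_at_0; have [T SK TK] := bijS.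
pose X0 := space0 S A; pose XZ := spaceZ S A.
have lam_gt0 i : (0 < lam i)%R by have /andP[] := lam01 i.
have LambdaZ1 : LambdaZ [set: X] = 1.
  by rewrite LambdaZ_ext//; exact: (@measurableT _ X0).
have LambdaZ_lty : LambdaZ [set: XZ] < +oo by rewrite LambdaZ1 ltry.
(* Restricting to the whole space changes no value but supplies the finite measure structure. *)
pose LZ : {finite_measure set XZ -> \bar R} := mfrestr measurableT LambdaZ_lty.
have LZE B : LZ B = LambdaZ B by rewrite /LZ/= /mfrestr /mrestr setIT.
have LZ_inv : invariant_measure (S : XZ -> XZ) LZ.
  by move=> B mB; have := LambdaZ_inv B mB; rewrite -!LZE.
have LZ_ext (B : set X0) : measurable B -> LZ B = Lambda B.
  by move=> mB; rewrite LZE LambdaZ_ext.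
have LZ_sum (B : set XZ) : measurable B ->
    LZ B = \esum_(i in [set: I]) ((lam i)%:E * L i B).
  by move=> mB; rewrite LZE LambdaZ_sum.
pose f i x := Num.max (Zi i x) 0%R.
have f_ge0 i x : (0 <= f i x)%R by rewrite le_max lexx orbT.
have f_RN i : RN_version (T := X0) (L i) phi0 (f i).
  by apply: RN_version_maxr0 => // B; exact: measure_ge0.
have /choice[b bP] := fun i => inverse_ess_sup (Zi_RN i).
have b_ge0 i : (0 <= b i)%R by have [] := bP i.
have bE i : (M i)^-1 = (b i)%:E by rewrite M_def; have [] := bP i.
(* Truncating at 0 does not affect these superlevel sets, so the properties of [b] carry over from
   [Zi] to [f]. *)
have fZi i s : (0 <= s)%R ->
    [set x | (1 < s * f i x)%R] = [set x | (1 < s * Zi i x)%R].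
  move=> s0; apply/seteqP; split => x /=; rewrite /f.
    by have [_|//] := leP (Zi i x) 0%R; rewrite mulr0 ltr10.
  by move=> /lt_le_trans; apply; rewrite ler_wpM2l// le_max lexx.
have b_upper i s : (b i < s)%R -> L i [set x | (1 < s * f i x)%R] != 0.
  move=> bs; rewrite fZi; last by rewrite ltW// (le_lt_trans _ bs).
  by have [_ _ + _] := bP i; exact.
have b_lower i : L i [set x | (1 < b i * f i x)%R] = 0.
  by rewrite fZi//; have [] := bP i.
under eq_esum do rewrite bE.
set Bs := \esum_(i in _) _.
have sing i j : i != j ->
    let P : set X0 := [set x | (f j x < f i x)%R] in
    [/\ measurable P, L i (~` P) = 0 & L j P = 0].
  move=> ij; apply: (ergodic_distinct_singular SK TK (f_ge0 i) (f_ge0 j)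
    (f_RN i) (f_RN j) (L_ergodic i) (L_ergodic j)).
  exact: L_distinct.
pose P i j : set X0 := [set x | (f j x < f i x)%R].
(* [F i] will be the intersection of all [P i j] with [j] other than [i], taken along the codes of
   indices; the code of [i] and numbers coding nothing impose no condition. *)
pose G i n : set X0 :=
  if @pickle_inv I n is Some j then if j == i then setT else P i j else setT.
have mG i n : measurable (G i n).
  rewrite /G; case: pickle_inv => [j|//]; case: eqVneq => // ji.
  by have [] := sing i j; rewrite 1?eq_sym.
pose F i : set X0 := \bigcap_n G i n.
have mF i : measurable (F i) by exact: bigcap_measurable.
have FP i j : j != i -> F i `<=` P i j.
  by move=> ji x /(_ (pickle j) Logic.I); rewrite /G pickleK_inv (negbTE ji).
have tF : trivIset setT F.
  apply/trivIsetP => i j _ _ ij; rewrite -subset0 => x [Fi Fj].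
  have := FP i j _ _ Fi; rewrite eq_sym => /(_ ij) fij.
  have /lt_trans := FP j i ij _ Fj => /(_ _ fij).
  by rewrite ltxx.
have mZ (B : set X0) : measurable B -> measurable (B : set XZ).
  exact: measurable_space0_spaceZ.
have F1 i : L i (~` F i) = 0.
  have mGC n : measurable (~` G i n : set XZ) by apply: mZ; exact: measurableC.
  rewrite /F setC_bigcap; apply/(negligibleP (L i)).
    by apply: bigcup_measurable => n _; exact: mGC.
  apply: negligible_bigcup => n; apply/(negligibleP (L i) (mGC n)).
  rewrite /G; case: pickle_inv => [j|]; last by rewrite setCT measure0.
  case: eqVneq => [_|ji]; first by rewrite setCT measure0.
  by have [] := sing i j; rewrite 1?eq_sym.
have F0 i j : j != i -> L j (F i) = 0.
  move=> ji; have [|mP _ P0] := sing i j; first by rewrite eq_sym.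
  exact: (@subset_measure0 _ XZ R (L j) _ _ (mZ _ (mF i)) (mZ _ mP) (FP _ _ ji)).
pose kappa i (a : R) : R := (lam i `^ a * b i `^ (1 - a))%R.
have lower (s : seq I) (a : R) : (0 <= a <= 1)%R -> uniq s ->
    \sum_(i <- s) ((kappa i a)%:E * L i Q) <= Hausd phi0 Z a Q.
  move=> a01 us; rewrite (Hausd_tail_outer SK TK).
  exact: (tail_outer_powR_lower SK TK Z_ge0 Z_RN LZ_ext lam_gt0 L_ergodic
    LZ_sum f_ge0 f_RN mF tF F1 b_ge0 b_lower).
have upper (w : {finite_measure set X0 -> \bar R}) (c : R) : (0 <= c)%R ->
    (forall B : set X0, measurable B ->
      w B <= c%:E * Lambda B + phi0 (B `&` [set x | (0 < Z x)%R])) ->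
    tail_outer (T : X0 -> X0) w Q <= c%:E + Bs.
  move=> c0 wle; have := tail_outer_upper SK TK Z_ge0 Z_RN LZ_inv LZ_ext lam_gt0
    L_ergodic LZ_sum f_ge0 f_RN mF F1 F0 b_ge0 c0 wle b_upper measQ.
  move=> /le_trans; apply; rewrite leeD2r// -[leRHS]mule1 lee_wpmul2l//.
  rewrite LZE -LambdaZ1; apply: le_measure; rewrite ?inE//.
(* This is the lower bound at [a = 0], where [kappa i 0 = b i]. *)
have Bs_Phi : Bs <= Phi phi0 Q.
  apply: ge_ereal_sup => _ [J [finJ _] <-]; rewrite fsbig_finite//=.
  rewrite -(Hausd0 phi0 Z Q SK TK).
  have := @lower (finmap.enum_fset (fset_set J)) 0%R;
  rewrite lexx ler01 finmap.fset_uniq => /(_ erefl erefl).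
  apply: le_trans; apply: lee_sum => i _.
  by rewrite /kappa powRr0 mul1r subr0 powRr1.
have Phi_fin : Phi phi0 Q \is a fin_num.
  by rewrite (Phi_tail_outer SK TK); exact: tail_outer_fin_num.
have Bs_ge0 : 0 <= Bs.
  by apply: esum_ge0 => i _; rewrite mule_ge0 ?lee_fin.
have Bs_fin : Bs \is a fin_num.
  by rewrite ge0_fin_numE// (le_lt_trans Bs_Phi)// ltey_eq Phi_fin.
have right_limit : Hausd phi0 Z a Q @[a --> 0%R^'+] --> Bs.
  rewrite -(fineK Bs_fin); apply: ereal_cvg_squeeze => e e0.
  (* A finite partial sum within [e] of [Bs] reduces the lower estimate to the convergence of
     finitely many [kappa i a]; the upper estimate needs only [a <= e]. *)
  have [_ [J [finJ _] <-] ltJ] := ub_ereal_sup_adherent e0 Bs_fin.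
  pose s : seq I := finmap.enum_fset (fset_set J); pose l i := fine (L i Q).
  have lE i : L i Q = (l i)%:E by rewrite fineK//; exact: fin_num_measure.
  have ltv : (fine Bs - e < \sum_(i <- s) b i * l i)%R.
    have vE : (\sum_(i <- s) b i * l i)%:E = \sum_(i <- s) ((b i)%:E * L i Q).
      by rewrite -sumEFin; apply: eq_bigr => i _; rewrite EFinM -lE.
    by rewrite -lte_fin vE EFinB fineK//; move: ltJ; rewrite fsbig_finite.
  have cvgv : (\sum_(i <- s) kappa i a * l i)%R @[a --> 0%R^'+] -->
      (\sum_(i <- s) b i * l i)%R.
    apply: cvg_big => [|i _]; first exact: add_continuous.
    apply: cvgM; last exact: cvg_cst.
    exact: cvg_powR_mean.
  have le_e : \forall a \near 0%R^'+, (a <= e)%R by exact: nbhs_right_le.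
  near=> a.
  have a0 : (0 < a)%R by near: a; exact: nbhs_right_gt.
  have a1 : (a < 1)%R by near: a; exact: nbhs_right_lt.
  apply/andP; split.
    apply: (@le_trans _ _ (\sum_(i <- s) kappa i a * l i)%R%:E).
      by rewrite lee_fin ltW//; near: a; exact: cvgr_gt cvgv _ ltv.
    have := @lower s a; rewrite ltW//= ltW//= finmap.fset_uniq => /(_ erefl erefl).
    apply: le_trans; rewrite -sumEFin; apply: lee_sum => i _.
    by rewrite EFinM -lE.
  have mP := measurable_set_ltr (measurable_cst (0%R : R)) Z_RN.1.
  pose w := comparison_measure (NngNum (ltW a0)) Lambda phi0 mP.
  have wE B : w B = a%:E * Lambda B + phi0 (B `&` [set x | (0 < Z x)%R]).
    exact: comparison_measureE.
  apply: (@le_trans _ _ (tail_outer (T : X0 -> X0) w Q)).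
    rewrite (Hausd_tail_outer SK TK); apply: le_tail_outer_fun => [B|B mB].
      by apply: integral_ge0 => x _; rewrite lee_fin powR_ge0.
    by rewrite wE; apply: integral_powR_le => //; rewrite a0.
  have w_le (B : set X0) : measurable B ->
      w B <= a%:E * Lambda B + phi0 (B `&` [set x | (0 < Z x)%R]).
    by rewrite wE.
  apply: le_trans (upper w a (ltW a0) w_le) _.
  rewrite -[Bs in leLHS](fineK Bs_fin) -EFinD lee_fin addrC lerD2l.
  by near: a.
have continuous_iff : continuous_at_0 <-> Phi phi0 Q = Bs.
  rewrite /continuous_at_0 (Hausd0 phi0 Z Q SK TK); split=> [cont|PhiE].
    apply: (cvg_unique (@ereal_hausdorff R) _ right_limit).
    apply: cvg_trans cont; apply: cvg_app => U; rewrite /within/= => nU.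
    have nU' : \forall a \near 0%R^'+, a \in `[0%R, 1%R] -> U a.
      rewrite /at_right near_withinE; near=> a => _; near: a; exact: nU.
    near=> a; have : (0 <= a <= 1)%R.
      apply/andP; split; first by near: a; exact: nbhs_right_ge.
      by near: a; exact: nbhs_right_le.
    have : a \in `[0%R, 1%R] -> U a by near: a.
    by rewrite in_itv/=.
  (* Near 0 in the unit interval there are only the points [a > 0], governed by the right limit, and
     [a = 0] itself, where the value is [Bs] by assumption. *)
  rewrite PhiE => U BsU.
  have nU : \forall a \near 0%R^'+, U (Hausd phi0 Z a Q) := right_limit U BsU.
  suff : \forall a \near within [set` `[0%R, 1%R]] (nbhs (0%R : R)),
    U (Hausd phi0 Z a Q) by [].
  rewrite near_withinE; move: nU; rewrite /at_right near_withinE => nU.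
  near=> a; rewrite /= in_itv/= => /andP[].
  rewrite le_eqVlt => /predU1P[<- _|a0 _].
    by rewrite (Hausd0 phi0 Z Q SK TK) PhiE; exact: nbhs_singleton.
  by move: a0; near: a.
split=> // phi0_Lambda; apply/continuous_iff; apply/eqP; rewrite eq_le Bs_Phi andbT.
(* The upper bound is applied to [phi0] with [c = 0]: the set where [Z = 0] is [Lambda]-null, hence
   [phi0]-null by absolute continuity. *)
rewrite (Phi_tail_outer SK TK) -[Bs]add0e; apply: upper => // B mB.
rewrite mul0e add0e; have [mfZ ZE] := Z_RN.
have mP := measurable_set_ltr (measurable_cst (0%R : R)) mfZ.
have mBD : measurable (B `\` [set x | (0 < Z x)%R]) by exact: measurableD.
have BD0 : Lambda (B `\` [set x | (0 < Z x)%R]) = 0.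
  rewrite ZE// integral0_eq// => x [_ /negP]; rewrite -leNgt => Zx.
  by apply/eqP; rewrite eqe eq_le Zx Z_ge0.
rewrite (measureDI _ mB mP) [X in X + _](_ : _ = 0) ?add0e//.
by move/null_content_dominatesP : phi0_Lambda; apply.
Unshelve. all: by end_near. Qed.
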